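(* Let $m,r,s\ge 1$ be integers. Let $A\in (C^{(s-1)})^{m\times m}$ and $A_k\in (C^{(s-1)})^{m\times m}$ for $k\in\mathbb{N}$, and let $B\colon (C^{(s)})^{m}\to\mathbb{C}^{r}$ and $B_k\colon (C^{(s)})^{m}\to\mathbb{C}^{r}$, $k\in\mathbb{N}$, be continuous linear operators. For $y\in (C^{(s)})^m$ put $Ly:=y'+Ay$ and $L_ky:=y'+A_ky$, and consider the continuous linear operators $$(L,B),\ (L_k,B_k)\colon (C^{(s)})^m\to (C^{(s-1)})^m\times\mathbb{C}^r,\qquad y\mapsto (Ly,By),\quad y\mapsto(L_ky,B_ky).$$ Suppose that, as $k\to\infty$, $(L_k,B_k)$ converges to $(L,B)$ in the strong operator topology. Then for all sufficiently large $k$ $$\dim\ker(L_k,B_k)\le\dim\ker(L,B),\qquad \dim\operatorname{coker}(L_k,B_k)\le\dim\operatorname{coker}(L,B).$$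
   Context: Fix a finite interval $[a,b]$, $a<b$. $C^{(0)}$ is the complex Banach space of continuous functions $x\colon[a,b]\to\mathbb{C}$ with norm $\|x\|_{(0)}=\max_{[a,b]}|x(t)|$; for $l\in\mathbb{N}$, $l\ge1$, $C^{(l)}$ is the complex Banach space of $l$ times continuously differentiable functions $x\colon[a,b]\to\mathbb{C}$ with norm $\|x\|_{(l)}=\sum_{j=0}^{l}\|x^{(j)}\|_{(0)}$. $(C^{(l)})^m$ denotes the space of (column) vector-valued functions with $m$ components in $C^{(l)}$, with norm the sum of the norms of the components; $(C^{(l)})^{m\times m}$ denotes the space of $m\times m$ matrix-valued functions with entries in $C^{(l)}$, with norm the maximum of the norms of its columns in $(C^{(l)})^m$. The space $(C^{(s-1)})^m\times\mathbb{C}^r$ carries any standard product norm. Convergence in the strong operator topology means $(L_ky,B_ky)\to(Ly,By)$ in $(C^{(s-1)})^m\times\mathbb{C}^r$ for every $y\in(C^{(s)})^m$. For a linear operator $T\colon X\to Y$, $\operatorname{coker}T:=Y/T(X)$. *)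

(* Defs.v *)
From HB Require Import structures.
From mathcomp Require Import all_boot all_order all_algebra.
From mathcomp Require Import all_classical all_reals all_analysis.
From mathcomp Require Import complex.
Set Implicit Arguments.
Unset Strict Implicit.
Unset Printing Implicit Defensive.
Import Order.TTheory GRing.Theory Num.Theory.
Import numFieldNormedType.Exports.
Import ComplexField.Normc.
Local Open Scope classical_set_scope.
Local Open Scope ring_scope.
Local Open Scope complex_scope.

(* The usual topology and norm of the complex numbers, as a normed space over
   themselves. *)
HB.instance Definition _ (R : rcfType) := NormedModule.copy R[i] R[i]^o.

Section Kernel.
Variables (K : fieldType) (X Y : lmodType K) (T : {linear X -> Y}).

Definition ker_pred : {pred X} := [pred x | T x == 0].

Lemma ker_pred_closed : submod_closed ker_pred.
Proof.
split=> [|c x y]; first by rewrite inE linear0.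
by rewrite !inE linearP => /eqP -> /eqP ->; rewrite scaler0 addr0.
Qed.
HB.instance Definition _ := GRing.isSubmodClosed.Build K X ker_pred
  ker_pred_closed.

Definition ker := {x : X | x \in ker_pred}.
HB.instance Definition _ := SubType.on ker.
HB.instance Definition _ := [Choice of ker by <:].
HB.instance Definition _ := [SubChoice_isSubLmodule of ker by <:].

Definition im_pred : {pred Y} := [pred y | `[< exists x, T x = y >]].

Lemma im_pred_closed : submod_closed im_pred.
Proof.
split=> [|c y z]; rewrite !unfold_in /=.
  by apply/asboolP; exists 0; rewrite linear0.
move=> /asboolP[x <-] /asboolP[u <-]; apply/asboolP.
by exists (c *: x + u); rewrite linearP.
Qed.
HB.instance Definition _ := GRing.isSubmodClosed.Build K Y im_pred
  im_pred_closed.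

(* The quotient of [Y] by [T(X)]; the library provides its additive group
   structure only. *)
Definition coker := Quotient.quot im_pred.
HB.instance Definition _ := Choice.on coker.
HB.instance Definition _ := GRing.Zmodule.on coker.
HB.instance Definition _ := ZmodQuotient.on coker.

Local Open Scope quotient_scope.

Definition coker_scale (c : K) (q : coker) : coker := \pi_coker (c *: repr q).

Lemma coker_scale_pi c y :
  coker_scale c (\pi_coker y) = \pi_coker (c *: y).
Proof.
apply/eqP; rewrite -Quotient.idealrBE -scalerBr rpredZ//.
by rewrite Quotient.idealrBE reprK.
Qed.

Let pi_ind (P : coker -> Prop) : (forall y, P (\pi_coker y)) -> forall q, P q.
Proof. by move=> h q; rewrite -[q]reprK. Qed.

Lemma coker_pi_eq0 y : \pi_coker y = 0 <-> exists x, T x = y.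
Proof.
have -> : 0 = \pi_coker 0 by rewrite pi_zeror.
split=> [/eqP|[x xy]]; [|apply/eqP]; rewrite -Quotient.idealrBE subr0.
  by rewrite unfold_in /= => /asboolP.
by rewrite unfold_in /=; apply/asboolP; exists x.
Qed.

Lemma coker_piD : {morph \pi_coker : y z / y + z}.
Proof. exact: pi_addr. Qed.

Lemma coker_scaleA c d q :
  coker_scale c (coker_scale d q) = coker_scale (c * d) q.
Proof.
by elim/pi_ind: q => y; rewrite !coker_scale_pi scalerA.
Qed.

Lemma coker_scale1 : left_id 1 coker_scale.
Proof. by elim/pi_ind => y; rewrite coker_scale_pi scale1r. Qed.

Lemma coker_scaleDr : right_distributive coker_scale +%R.
Proof.
move=> c; elim/pi_ind => y; elim/pi_ind => z.
by rewrite !coker_scale_pi -!coker_piD coker_scale_pi scalerDr.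
Qed.

Lemma coker_scaleDl q : {morph coker_scale^~ q : c d / c + d}.
Proof.
move=> c d; elim/pi_ind: q => y.
by rewrite !coker_scale_pi scalerDl coker_piD.
Qed.

HB.instance Definition _ := GRing.Zmodule_isLmodule.Build K coker
  coker_scaleA coker_scale1 coker_scaleDr coker_scaleDl.

End Kernel.

Section Dimension.
Variables (R : realType) (K : fieldType) (V : lmodType K).

Definition is_basis n (e : 'I_n -> V) : Prop :=
  (forall c : 'I_n -> K, \sum_i c i *: e i = 0 -> forall i, c i = 0) /\
  (forall v, exists c : 'I_n -> K, v = \sum_i c i *: e i).

(* All finite bases have the same size (see [dimension_basis]); the infimum of
   the empty set is +oo, so [dimension] is +oo when there is no finite basis. *)
Definition dimension : \bar R :=
  ereal_inf [set n%:R%:E | n in [set n | exists e : 'I_n -> V, is_basis e]].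

Lemma basis_size_le n p (e : 'I_n -> V) (f : 'I_p -> V) :
  is_basis e -> is_basis f -> (n <= p)%N.
Proof.
move=> [efree _] [_ fspan].
have /choice[g gP] : forall i, exists c : 'I_p -> K, e i = \sum_j c j *: f j.
  by move=> i; exact: fspan.
pose M : 'M[K]_(n, p) := \matrix_(i, j) g i j.
suff : row_free M by rewrite /row_free => /eqP <-; exact: rank_leq_col.
apply/row_freeP; apply: contrapT => nM.
have /rowV0Pn[u uker u0] : kermx M != 0.
  apply/negP => /eqP kM0; apply: nM; apply/row_freeP.
  by rewrite -kermx_eq0 kM0.
have uM : u *m M = 0 by exact/sub_kermxP.
case/eqP: u0; apply/rowP => i; rewrite mxE.
apply: (efree (fun i => u 0 i)).
under eq_bigr do rewrite gP scaler_sumr.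
rewrite exchange_big big1//= => j _.
under eq_bigr do rewrite scalerA.
rewrite -scaler_suml.
move/rowP/(_ j) : uM; rewrite !mxE => h.
rewrite (_ : \sum_i _ = 0) ?scale0r// -[RHS]h.
by apply: eq_bigr => k _; rewrite mxE.
Qed.

Lemma dimension_basis n (e : 'I_n -> V) : is_basis e -> dimension = n%:R%:E.
Proof.
move=> eb; rewrite /dimension.
rewrite (_ : [set _ | _ in _] = [set n%:R%:E]) ?ereal_inf1//.
apply/seteqP; split=> [_ [p [f fb]] <-|_ ->] /=.
  rewrite (_ : p = n)//; apply/eqP.
  by rewrite eqn_leq (basis_size_le fb eb) (basis_size_le eb fb).
by exists n => //; exists e.
Qed.

End Dimension.
Arguments dimension R {K} V.

Section Derivative.
Variables (R : realType) (a b : R).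

Local Notation I := (`[a, b]%classic).

Definition diff_quot (x : I -> R[i]) (t s : I) : R[i] :=
  ((val s - val t)%:C)^-1 * (x s - x t).

Definition differentiable_itv (x : I -> R[i]) : Prop :=
  forall t : I, cvg (diff_quot x t s @[s --> t^']).

(* [t^'] is the punctured neighborhood filter of [t] in the subspace [a, b], so
   the derivatives at [a] and [b] are the one-sided ones. *)
Definition deriv_itv (x : I -> R[i]) : I -> R[i] :=
  fun t => lim (diff_quot x t s @[s --> t^']).

Fixpoint cont_diff (l : nat) (x : I -> R[i]) : Prop :=
  if l is l'.+1 then differentiable_itv x /\ cont_diff l' (deriv_itv x)
  else continuous x.

(* The supremum is a maximum when [x] is continuous. *)
Definition sup_norm (x : I -> R[i]) : R := sup (range (fun t => normc (x t))).

Definition Cl_norm l (x : I -> R[i]) : R :=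
  \sum_(j < l.+1) sup_norm (iter j deriv_itv x).

Hypothesis ab : a < b.

Lemma seg_dnbhs_proper (t : I) : ProperFilter t^'.
Proof.
apply: Build_ProperFilter_ex => A /nbhs_ballP[e /= e0 tA].
have tab := set_valP t; rewrite /= in_itv/= in tab.
case/andP: tab => at_ tb.
suff [s [sab st se]] : exists s,
    [/\ a <= s <= b, s != val t & `|val t - s| < e].
  have sI : s \in `[a, b]%classic by rewrite inE/= in_itv.
  exists (exist _ s sI); apply: tA; first exact: se.
  by apply: contra_neq st => <-.
have [tb'|bt] := ltP (val t) b.
  exists (Num.min (val t + e / 2) b); split.
  - rewrite le_min (ltW ab) ge_min lexx orbT !andbT.
    by rewrite (le_trans at_)// lerDl divr_ge0// ltW.
  - by rewrite gt_eqF// lt_min tb' ltrDl divr_gt0.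
  - rewrite ler0_norm ?subr_le0 ?le_min ?tb ?andbT ?lerDl ?divr_ge0// ?ltW//.
    rewrite opprB ltrBlDl gt_min ltrD2l ltr_pdivrMr// ltr_pMr// ltr1n//.
have {bt tb} tb : val t = b by apply/eqP; rewrite eq_le tb bt.
exists (Num.max (val t - e / 2) a); split.
- rewrite ge_max (ltW ab) le_max lexx orbT !andbT/=.
  by rewrite tb gerBl divr_ge0// ltW.
- by rewrite lt_eqF// gt_max tb ab andbT gtrBl divr_gt0.
- rewrite ger0_norm ?subr_ge0 ?ge_max ?at_ ?andbT ?gerBl ?divr_ge0// ?ltW//.
  rewrite ltrBlDr -ltrBlDl lt_max ltrD2l ltrN2 ltr_pdivrMr// ltr_pMr// ltr1n//.
Qed.
#[local] Existing Instance seg_dnbhs_proper.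

Definition is_deriv_itv (x : I -> R[i]) (t : I) (l : R[i]) : Prop :=
  diff_quot x t s @[s --> t^'] --> l.

Lemma is_deriv_itvE x t l : is_deriv_itv x t l -> deriv_itv x t = l.
Proof. by move=> xl; apply: cvg_lim => //; exact: norm_hausdorff. Qed.

Lemma differentiable_itvP x t : differentiable_itv x ->
  is_deriv_itv x t (deriv_itv x t).
Proof. by move=> /(_ t). Qed.

Lemma is_deriv_itv_lin c x y t l k :
  is_deriv_itv x t l -> is_deriv_itv y t k ->
  is_deriv_itv (c *: x + y) t (c *: l + k).
Proof.
move=> xl yk; rewrite /is_deriv_itv.
rewrite (_ : diff_quot _ _ = fun s => c *: diff_quot x t s + diff_quot y t s).
  exact: (cvgD (cvgZr xl) yk).
apply/funext => s; rewrite /diff_quot/= /GRing.scale/=.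
rewrite mulrCA -mulrDr; congr (_ * _).
by rewrite [c * _]mulrBr opprD addrACA.
Qed.

Lemma real_complex_continuous : continuous (fun u : R => u%:C).
Proof.
move=> u; apply/(@cvgrPdist_lt _ R[i]) => e e0; apply/nbhs_ballP.
move: (e0); rewrite ltcE/= => /andP[/eqP Ime Ree].
exists (complex.Re e) => //= v /= uv.
rewrite -rmorphB/= normc_def/= expr0n/= addr0 sqrtr_sqr ltcE/= Ime eqxx/=.
exact: uv.
Qed.

Lemma seg_id_cvg (t : I) : (val s - val t)%:C @[s --> t^'] --> (0 : R[i]).
Proof.
have vt : val s @[s --> t^'] --> val t.
  apply: cvg_trans; last exact: (@initial_continuous I R set_val t).
  exact: cvg_app (@cvg_within _ _ _ _).
have vt0 : val s - val t @[s --> t^'] --> (0 : R).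
  rewrite -(subrr (val t)); exact: (cvgB vt (cvg_cst _)).
exact: (cvg_comp _ _ vt0 (@real_complex_continuous 0)).
Qed.

Lemma is_deriv_itv_cvg x t l : is_deriv_itv x t l ->
  x s @[s --> t^'] --> x t.
Proof.
move=> xl.
have h : (val s - val t)%:C * diff_quot x t s + x t @[s --> t^'] --> x t.
  have e : 0 * l + x t = x t by rewrite mul0r add0r.
  rewrite -[X in _ --> X]e.
  exact: (cvgD (cvgM (seg_id_cvg t) xl) (cvg_cst (x t))).
apply: cvg_trans h; apply: near_eq_cvg.
rewrite /prop_near1 /dnbhs /within/=; apply: nearW => s st.
rewrite /diff_quot mulrA mulfV ?mul1r ?subrK//.
apply: contra_neq st => /eqP; rewrite -(rmorph0 (real_complex R)).
by rewrite (inj_eq (@complexI R)) subr_eq0 => /eqP h; exact: val_inj.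
Qed.

Lemma differentiable_continuous x : differentiable_itv x -> continuous x.
Proof.
move=> dx t; have := is_deriv_itv_cvg (@differentiable_itvP x t dx).
move=> xt A xtA; have := xt A xtA; rewrite /dnbhs /within.
apply: (@filterS _ (nbhs t) (nbhs_filter t)) => s sA.
have [->|/sA//] := eqVneq s t.
exact: nbhs_singleton xtA.
Qed.

Lemma is_deriv_itvM x y t l k : is_deriv_itv x t l -> is_deriv_itv y t k ->
  is_deriv_itv (fun s => x s * y s) t (l * y t + x t * k).
Proof.
move=> xl yk.
have h := cvgD (cvgM xl (is_deriv_itv_cvg yk)) (cvgM (cvg_cst (x t)) yk).
rewrite /is_deriv_itv.
rewrite (_ : diff_quot _ _ =
  fun s => diff_quot x t s * y s + x t * diff_quot y t s); first exact: h.
apply/funext => s; rewrite /diff_quot.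
set q := _^-1; rewrite [x t * (q * _)]mulrCA -[q * _ * _]mulrA -mulrDr.
by congr (q * _); rewrite mulrBl mulrBr addrA subrK.
Qed.


Lemma differentiable_itvD c x y : differentiable_itv x ->
  differentiable_itv y -> differentiable_itv (c *: x + y).
Proof.
move=> dx dy t.
have := is_deriv_itv_lin (c := c) (@differentiable_itvP x t dx)
  (@differentiable_itvP y t dy).
exact: cvgP.
Qed.

Lemma deriv_itvD c x y : differentiable_itv x -> differentiable_itv y ->
  deriv_itv (c *: x + y) = c *: deriv_itv x + deriv_itv y.
Proof.
move=> dx dy; apply/funext => t; apply: is_deriv_itvE.
exact: (is_deriv_itv_lin (c := c) (@differentiable_itvP x t dx)
  (@differentiable_itvP y t dy)).
Qed.

Lemma differentiable_itvM x y : differentiable_itv x ->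
  differentiable_itv y -> differentiable_itv (fun s => x s * y s).
Proof.
move=> dx dy t.
have := is_deriv_itvM (@differentiable_itvP x t dx)
  (@differentiable_itvP y t dy).
exact: cvgP.
Qed.

Lemma deriv_itvM x y : differentiable_itv x -> differentiable_itv y ->
  deriv_itv (fun s => x s * y s) =
  (fun s => deriv_itv x s * y s) + (fun s => x s * deriv_itv y s).
Proof.
move=> dx dy; apply/funext => t; apply: is_deriv_itvE.
exact: (is_deriv_itvM (@differentiable_itvP x t dx)
  (@differentiable_itvP y t dy)).
Qed.

Lemma deriv_itv0 : differentiable_itv 0 /\ deriv_itv 0 = 0.
Proof.
have h t : is_deriv_itv 0 t 0.
  rewrite /is_deriv_itv (_ : diff_quot _ _ = cst 0); first exact: cvg_cst.
  by apply/funext => s; rewrite /diff_quot subrr mulr0.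
split=> [t|]; first by apply/cvg_ex; exists 0; exact: h.
by apply/funext => t; apply: is_deriv_itvE; exact: h.
Qed.

Lemma cont_diff0 l : cont_diff l 0.
Proof.
elim: l => [|l ihl]; first exact: (@cst_continuous I R[i] 0).
rewrite /=; by have [d0 ->] := deriv_itv0.
Qed.

Lemma cont_diffD l c x y :
  cont_diff l x -> cont_diff l y -> cont_diff l (c *: x + y).
Proof.
elim: l x y => [|l ihl] x y /=.
  by move=> cx cy t; exact: (cvgD (cvgZr (cx t)) (cy t)).
move=> [dx cx] [dy cy]; split; first exact: differentiable_itvD.
by rewrite deriv_itvD//; exact: ihl.
Qed.

Lemma cont_diffW l x : cont_diff l.+1 x -> cont_diff l x.
Proof.
elim: l x => [|l ihl] x; first by case=> dx _; exact: differentiable_continuous.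
by case=> dx /ihl cx; split.
Qed.

Lemma cont_diff_deriv l x : cont_diff l.+1 x -> cont_diff l (deriv_itv x).
Proof. by case. Qed.

Lemma cont_diffM l x y :
  cont_diff l x -> cont_diff l y -> cont_diff l (fun s => x s * y s).
Proof.
elim: l x y => [|l ihl] x y.
  by move=> cx cy t; exact: (cvgM (cx t) (cy t)).
move=> cdx cdy; have [dx cx] := cdx; have [dy cy] := cdy.
split; first exact: differentiable_itvM.
rewrite deriv_itvM// -[X in X + _]scale1r.
by apply: cont_diffD; apply: ihl => //; exact: cont_diffW.
Qed.

Lemma cont_diff_iter l j x : (j <= l)%N -> cont_diff l x ->
  cont_diff (l - j) (iter j deriv_itv x).
Proof.
elim: j => [|j ihj] jl cx; first by rewrite subn0.
by have := ihj (ltnW jl) cx; rewrite -subnSK//= => -[].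
Qed.

Lemma cont_diff_continuous l x : cont_diff l x -> continuous x.
Proof. by elim: l => [//|l ihl] /cont_diffW. Qed.

Lemma iter_deriv_itvD l j c x y : (j <= l)%N ->
  cont_diff l x -> cont_diff l y ->
  iter j deriv_itv (c *: x + y) = c *: iter j deriv_itv x + iter j deriv_itv y.
Proof.
move=> + cx cy; elim: j => [//|j ihj] jl.
rewrite 3!iterS ihj 1?ltnW// deriv_itvD//.
  by have := cont_diff_iter (ltnW jl) cx; rewrite -subnSK//= => -[].
by have := cont_diff_iter (ltnW jl) cy; rewrite -subnSK//= => -[].
Qed.

Lemma normc_ge0 (z : R[i]) : 0 <= normc z.
Proof. by rewrite -ler0c; exact: (normr_ge0 z). Qed.

Lemma normc_continuous : continuous (@normc R).
Proof.
move=> u; apply/(@cvgrPdist_lt R R _ (nbhs u) (nbhs_filter u)) => e e0.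
apply/nbhs_ballP.
exists (e%:C) => /=; first by rewrite ltcR.
move=> v /= uv; rewrite -ltcR; apply: le_lt_trans uv.
have h (z : R) : (`|z|)%:C = `|z%:C|.
  by rewrite normc_def/= expr0n/= addr0 sqrtr_sqr.
rewrite h rmorphB/=; exact: (@ler_dist_dist _ R[i] u v).
Qed.

Lemma seg_bounded (x : I -> R[i]) :
  continuous x -> has_ubound (range (fun t => normc (x t))).
Proof.
move=> cx; pose f t := normc (x t).
have cf : continuous f.
  by move=> t; exact: (cvg_comp _ _ (cx t) (@normc_continuous (x t))).
have cn : {within `[a, b], continuous (valL_ 0 f)}.
  exact/subspace_valL_continuousP'.
have [c _ cmax] := EVT_max (ltW ab) cn.
exists (valL_ 0 f c) => _ [t _ <-].
have := cmax (val t).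
rewrite -[valL_ 0 f (val t)]/(sigL `[a, b]%classic (valL_ 0 f) t).
rewrite valLK; apply; exact: (set_valP t).
Qed.

Lemma seg_point : I.
Proof. by exists a; rewrite inE/= in_itv/= lexx ltW. Qed.

Lemma sup_norm_ub x t : continuous x -> normc (x t) <= sup_norm x.
Proof.
move=> cx; apply: ub_le_sup; first exact: seg_bounded.
by exists t.
Qed.

Lemma sup_norm_le x M : (forall t, normc (x t) <= M) -> sup_norm x <= M.
Proof.
move=> xM; apply: ge_sup; last by move=> _ [t _ <-].
by exists (normc (x seg_point)); exists seg_point.
Qed.

Lemma sup_norm_ge0 x : continuous x -> 0 <= sup_norm x.
Proof.
move=> cx; apply: le_trans (sup_norm_ub seg_point cx).
exact: normc_ge0.
Qed.

Lemma ler_sup_normD x y : continuous x -> continuous y ->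
  sup_norm (x + y) <= sup_norm x + sup_norm y.
Proof.
move=> cx cy; apply: sup_norm_le => t.
apply: le_trans (lerD (sup_norm_ub t cx) (sup_norm_ub t cy)).
by rewrite -lecR rmorphD; exact: (ler_normD (x t) (y t)).
Qed.

Lemma sup_normZ_le c x : continuous x ->
  sup_norm (c *: x) <= normc c * sup_norm x.
Proof.
move=> cx; apply: sup_norm_le => t.
by rewrite normcM ler_wpM2l ?sup_norm_ub ?normc_ge0.
Qed.

Lemma sup_normZ c x : continuous x -> sup_norm (c *: x) = normc c * sup_norm x.
Proof.
move=> cx; apply/eqP; rewrite eq_le sup_normZ_le//=.
have [->|c0] := eqVneq c 0.
  rewrite normc0 mul0r; apply: sup_norm_ge0.
  rewrite scale0r; exact: (@cst_continuous I R[i] 0).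
have nc0 : 0 < normc c.
  by rewrite -ltcR -[X in _ < X]/(`|c|) normr_gt0.
rewrite -ler_pdivlMl// -normcV -[in leLHS](scalerK c0 x).
by apply: sup_normZ_le => t; exact: (cvgZr (cx t)).
Qed.

Lemma sup_norm0_eq0 x : continuous x -> sup_norm x = 0 -> x = 0.
Proof.
move=> cx x0; apply/funext => t; apply: eq0_normc; apply/eqP.
by rewrite eq_le -{1}x0 sup_norm_ub//= normc_ge0.
Qed.

Lemma Cl_norm_ge0 l x : cont_diff l x -> 0 <= Cl_norm l x.
Proof.
move=> cx; apply: sumr_ge0 => j _; apply: sup_norm_ge0.
exact: (cont_diff_continuous (cont_diff_iter (leq_ord j) cx)).
Qed.

Lemma ler_Cl_normD l x y : cont_diff l x -> cont_diff l y ->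
  Cl_norm l (x + y) <= Cl_norm l x + Cl_norm l y.
Proof.
move=> cx cy; rewrite /Cl_norm -big_split/=; apply: ler_sum => j _.
have jl := leq_ord j.
rewrite -{1}[x]scale1r (iter_deriv_itvD 1 jl)// scale1r.
by apply: ler_sup_normD; apply: cont_diff_continuous (cont_diff_iter jl _).
Qed.

Lemma Cl_normZ l c x : cont_diff l x ->
  Cl_norm l (c *: x) = normc c * Cl_norm l x.
Proof.
move=> cx; rewrite /Cl_norm mulr_sumr; apply: eq_bigr => j _.
have jl := leq_ord j.
have i0 : iter j deriv_itv 0 = 0.
  by elim: (nat_of_ord j) => // k /= ->; case: deriv_itv0.
rewrite -[c *: x]addr0 (iter_deriv_itvD c jl)//; last exact: cont_diff0.
rewrite i0 addr0 sup_normZ//.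
exact: cont_diff_continuous (cont_diff_iter jl cx).
Qed.

Lemma Cl_norm0_eq0 l x : cont_diff l x -> Cl_norm l x = 0 -> x = 0.
Proof.
move=> cx; rewrite /Cl_norm big_ord_recl => /eqP.
have cxj (j : 'I_l.+1) : continuous (iter j deriv_itv x).
  exact: cont_diff_continuous (cont_diff_iter (leq_ord j) cx).
rewrite paddr_eq0; last 2 first.
- exact: (sup_norm_ge0 (cxj ord0)).
- by apply: sumr_ge0 => j _; exact: (sup_norm_ge0 (cxj (lift ord0 j))).
by move=> /andP[/eqP + _]; exact: (sup_norm0_eq0 (cxj ord0)).
Qed.

End Derivative.
Section SpaceCl.
Variables (R : realType) (a b : R) (ab : a < b) (l : nat).

(* The condition a < b makes every point of [a, b] a limit point, without which
   derivatives would not be unique. *)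
Definition Cl_pred of a < b : {pred (`[a, b]%classic -> R[i])} :=
  [pred x | `[< cont_diff l x >]].

Lemma Cl_predP x : reflect (cont_diff l x) (x \in Cl_pred ab).
Proof. exact: asboolP. Qed.

Lemma Cl_pred_closed : submod_closed (Cl_pred ab).
Proof.
split=> [|c x y]; first exact/Cl_predP/(cont_diff0 ab).
move=> /Cl_predP cx /Cl_predP cy; apply/Cl_predP.
exact: (cont_diffD ab).
Qed.
HB.instance Definition _ := GRing.isSubmodClosed.Build R[i] _ (Cl_pred ab)
  Cl_pred_closed.

Definition Cl := {x : `[a, b]%classic -> R[i] | x \in Cl_pred ab}.
HB.instance Definition _ := SubType.on Cl.
HB.instance Definition _ := [Choice of Cl by <:].
HB.instance Definition _ := [SubChoice_isSubLmodule of Cl by <:].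

Lemma ClP (x : Cl) : cont_diff l (val x).
Proof. exact/Cl_predP/(valP x). Qed.

Definition Cl_of x (cx : cont_diff l x) : Cl :=
  exist _ x (introT (Cl_predP x) cx).

Let norm (x : Cl) : R[i] := (Cl_norm l (val x))%:C.

Let normD x y : norm (x + y) <= norm x + norm y.
Proof. by rewrite -rmorphD lecR; exact: (ler_Cl_normD ab (ClP x) (ClP y)). Qed.

Let normZ c x : norm (c *: x) = `|c| * norm x.
Proof. by rewrite [LHS](congr1 _ (Cl_normZ ab c (ClP x))) rmorphM. Qed.

Let norm0_eq0 x : norm x = 0 -> x = 0.
Proof.
move=> /complexI h; apply: val_inj; exact: (Cl_norm0_eq0 ab (ClP x) h).
Qed.

HB.instance Definition _ := Lmodule_isNormed.Build R[i] Cl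
  normD normZ norm0_eq0.

Lemma Cl_normE (x : Cl) : `|x| = (Cl_norm l (val x))%:C.
Proof. by []. Qed.

End SpaceCl.
Arguments Cl {R a b} ab l.

Section Vectors.
Variables (K : numFieldType) (V : normedModType K) (m : nat).

(* Column vectors with [m] components in [V], normed by the sum of the norms of
   the components. The library's ['cV[V]_m] carries neither the [K]-module
   structure nor that norm. *)
Definition cvec := {ffun 'I_m -> V}.
HB.instance Definition _ := GRing.Lmodule.on cvec.

Let norm (y : cvec) : K := \sum_i `|y i|.

Let normD x y : norm (x + y) <= norm x + norm y.
Proof.
rewrite /norm -big_split/=; apply: ler_sum => i _.
by rewrite ffunE ler_normD.
Qed.

Let normZ c x : norm (c *: x) = `|c| * norm x.
Proof.
rewrite /norm mulr_sumr; apply: eq_bigr => i _.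
by rewrite ffunE normrZ.
Qed.

Let norm0_eq0 x : norm x = 0 -> x = 0.
Proof.
move=> /eqP; rewrite psumr_eq0 => [/allP x0|i _]; last exact: normr_ge0.
apply/ffunP => i; rewrite ffunE; apply/eqP; rewrite -normr_eq0.
by apply: (implyP (x0 i _)) => //; rewrite mem_index_enum.
Qed.

HB.instance Definition _ := Lmodule_isNormed.Build K cvec
  normD normZ norm0_eq0.

Lemma cvec_normE (y : cvec) : `|y| = \sum_i `|y i|.
Proof. by []. Qed.

End Vectors.

Section Operators.
Variables (R : realType) (a b : R) (ab : a < b) (l : nat).

Definition Cl_deriv (x : Cl ab l.+1) : Cl ab l :=
  Cl_of ab (cont_diff_deriv (ClP x)).

Definition Cl_incl (x : Cl ab l.+1) : Cl ab l := Cl_of ab (cont_diffW (ClP x)).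

Definition Cl_mul (x y : Cl ab l) : Cl ab l :=
  Cl_of ab (cont_diffM ab (ClP x) (ClP y)).

Lemma Cl_deriv_linear : linear Cl_deriv.
Proof.
move=> c x y; apply: val_inj.
by rewrite /= (deriv_itvD ab)//; [case: (ClP x)|case: (ClP y)].
Qed.
HB.instance Definition _ := GRing.isLinear.Build _ _ _ _ Cl_deriv
  Cl_deriv_linear.

Lemma Cl_incl_linear : linear Cl_incl.
Proof. by move=> c x y; apply: val_inj. Qed.
HB.instance Definition _ := GRing.isLinear.Build _ _ _ _ Cl_incl
  Cl_incl_linear.

Lemma Cl_mul_linear x : linear (Cl_mul x).
Proof.
move=> c y z; apply: val_inj; apply/funext => t /=.
by rewrite mulrDr/= /GRing.scale/= mulrCA.
Qed.
HB.instance Definition _ x := GRing.isLinear.Build _ _ _ _ (Cl_mul x)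
  (Cl_mul_linear x).

Variables (m : nat).

(* y |-> y' + A y *)
Definition ode_op (A : 'M[Cl ab l]_m) (y : cvec (Cl ab l.+1) m) :
    cvec (Cl ab l) m :=
  [ffun i => Cl_deriv (y i) + \sum_(j < m) Cl_mul (A i j) (Cl_incl (y j))].

Lemma ode_op_linear A : linear (ode_op A).
Proof.
move=> c y z; apply/ffunP => i; rewrite !ffunE linearP scalerDr addrACA.
congr (_ + _); rewrite scaler_sumr -big_split/=; apply: eq_bigr => j _.
by rewrite !ffunE !linearP.
Qed.
HB.instance Definition _ A := GRing.isLinear.Build _ _ _ _ (ode_op A)
  (ode_op_linear A).

Variables (r : nat).

Definition bvp_op (A : 'M[Cl ab l]_m)
    (B : {linear cvec (Cl ab l.+1) m -> 'cV[R[i]]_r})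
    (y : cvec (Cl ab l.+1) m) : cvec (Cl ab l) m * 'cV[R[i]]_r :=
  (ode_op A y, B y).

Lemma bvp_op_linear A B : linear (bvp_op A B).
Proof. by move=> c y z; rewrite /bvp_op !linearP. Qed.
HB.instance Definition _ A B := GRing.isLinear.Build _ _ _ _ (bvp_op A B)
  (bvp_op_linear A B).

End Operators.

(* Main.v *)
Require Import Defs.
From HB Require Import structures.
From mathcomp Require Import all_boot all_order all_algebra.
From mathcomp Require Import all_classical all_reals all_analysis.
From mathcomp Require Import complex.
From mathcomp Require Import ring lra.
Set Implicit Arguments.
Unset Strict Implicit.
Unset Printing Implicit Defensive.
Import Order.TTheory GRing.Theory Num.Theory.
Import numFieldNormedType.Exports.
Import ComplexField.Normc.
Local Open Scope classical_set_scope.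
Local Open Scope ring_scope.

(** The operator y |-> y' + Ay is onto, and its kernel is spanned by the m
    solutions e_1, ..., e_m with e_j(a) the j-th unit vector. Hence the kernel
    and the cokernel of (L, B) are those of the r x m characteristic matrix
    with columns B e_j ([dimension_ker], [dimension_coker]): their dimensions
    are m - rank and r - rank. Since the rank cannot drop under a small
    perturbation ([rank_near]), it suffices that the characteristic matrices of
    (L_k, B_k) converge to that of (L, B).

    Strong convergence applied to constant functions gives A_k -> A in C^(s-1)
    ([coef_cvg]). For fixed A, the norm of y in C^(s) is bounded by a multiple
    of |y(a)| + ||y' + Ay|| ([ivp_estimate]); applied to the differences of the
    fundamental solutions this yields e_{k,j} -> e_j in C^(s)
    ([solution_cvg]). Finally C^(s) is complete ([banach_Cl]), so the
    coordinates of the B_k, being pointwise convergent, are uniformly bounded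
    ([uniform_boundedness]), and
    B_k e_{k,j} - B e_j = B_k (e_{k,j} - e_j) + (B_k e_j - B e_j) -> 0.

    Solvability of the initial value problem and the estimate both come from
    one fact: conjugating the Volterra operator by the weight exp(lam (t - a))
    with lam large turns it into a contraction of ratio 1/2
    ([volterra_conj_contraction]). Higher regularity is gained one derivative
    at a time, by reading the equation as y' = f - Ay. *)

(** * Kernel and cokernel through the characteristic matrix *)

Section FredholmReduction.
Variables (R : realType) (K : fieldType) (X Y : lmodType K) (m r : nat).
Variables (L : {linear X -> Y}) (B : {linear X -> 'cV[K]_r}).
Variable T : {linear X -> (Y * 'cV[K]_r)%type}.
Hypothesis TE : forall x, T x = (L x, B x).
Variable e : 'I_m -> X.
Hypothesis Le0 : forall j, L (e j) = 0.
Hypothesis efree : forall c : 'I_m -> K,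
  \sum_j c j *: e j = 0 -> forall j, c j = 0.
Hypothesis egen : forall x,
  L x = 0 -> exists c : 'I_m -> K, x = \sum_j c j *: e j.
Hypothesis Lsurj : forall y, exists x, L x = y.

(** The transpose of the matrix with columns B (e j): coefficient vectors are
    rows and act on it from the left. *)
Definition char_mx : 'M[K]_(m, r) := \matrix_(j, i) B (e j) i 0.

Lemma char_mxE (u : 'rV[K]_m) : (B (\sum_j u 0 j *: e j))^T = u *m char_mx.
Proof.
apply/rowP => i; rewrite !mxE linear_sum summxE; apply: eq_bigr => j _.
by rewrite linearZ !mxE.
Qed.

Lemma T_kernel_comb (u : 'rV[K]_m) :
  T (\sum_j u 0 j *: e j) = (0, (u *m char_mx)^T).
Proof.
rewrite TE -char_mxE trmxK; congr (_, _).
by rewrite linear_sum big1// => j _; rewrite linearZ/= Le0 scaler0.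
Qed.

(** A solution of L x = 0 is a combination of the e j, and B kills it exactly
    when its row of coefficients lies in the left kernel of [char_mx]. *)
Lemma dimension_ker : dimension R (ker T) = (m - \rank char_mx)%:R%:E.
Proof.
rewrite -mxrank_ker; set N := kermx char_mx.
pose f0 (i : 'I_(\rank N)) : X := \sum_j row_base N i j *: e j.
have f0E i : f0 i = \sum_j (row i (row_base N)) 0 j *: e j.
  by rewrite /f0; apply: eq_bigr => j _; rewrite [in RHS]mxE.
have kerf i : f0 i \in ker_pred T.
  rewrite inE f0E T_kernel_comb.
  have /sub_kermxP -> : (row i (row_base N) <= kermx char_mx)%MS.
    by apply: submx_trans (row_sub _ _) _; rewrite eq_row_base.
  by rewrite trmx0.
pose f i : ker T := Sub (f0 i) (kerf i).
apply: (dimension_basis R (e := f)).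
have comb (c : 'I_(\rank N) -> K) : val (\sum_i c i *: f i) =
    \sum_j ((\row_i c i) *m row_base N) 0 j *: e j.
  have -> : val (\sum_i c i *: f i) = \sum_i c i *: f0 i.
    by elim/big_rec2: _ => // i x y _ <-.
  under eq_bigr do rewrite scaler_sumr.
  rewrite exchange_big; apply: eq_bigr => j _/=.
  rewrite mxE scaler_suml; apply: eq_bigr => i _.
  by rewrite scalerA; congr (_ * _ *: _); rewrite mxE.
split=> [c /(congr1 val)|[x kx]].
  rewrite comb => /(@efree (fun j => ((\row_i c i) *m row_base N) 0 j)) c0 i.
  have : (\row_i c i) *m row_base N = 0 by apply/rowP => j; rewrite c0 mxE.
  rewrite -[X in _ = X](mul0mx _ (row_base N)) => /(row_free_inj (row_base_free N)).
  by move/rowP => /(_ i); rewrite !mxE.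
have /eqP := kx; rewrite TE => -[Lx Bx].
have [c xE] := egen Lx.
pose u : 'rV[K]_m := \row_j c j.
have xu : x = \sum_j u 0 j *: e j by rewrite xE; apply: eq_bigr => j _; rewrite mxE.
have : (u <= row_base N)%MS.
  by rewrite eq_row_base; apply/sub_kermxP; rewrite -char_mxE -xu Bx trmx0.
case/submxP => d ud; exists (fun i => d 0 i); apply: val_inj; rewrite comb/= xu.
have -> : \row_i d 0 i = d by apply/rowP => i; rewrite mxE.
by rewrite -ud.
Qed.

(** As L is onto, every class of the cokernel has a representative (0, w), and
    (0, w) is in the image of T exactly when w is in the row space of
    [char_mx]; a basis of a complement of that row space gives a basis. *)
Lemma dimension_coker : dimension R (coker T) = (r - \rank char_mx)%:R%:E.
Proof.
rewrite -mxrank_compl; set N := (char_mx^C)%MS.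
pose v (w : 'rV[K]_r) : (Y * 'cV[K]_r)%type := (0, w^T).
pose p := \pi_(coker T)%qT.
pose f (i : 'I_(\rank N)) : coker T := p (v (row i (row_base N))).
have p0 : p 0 = 0 by apply/coker_pi_eq0; exists 0; rewrite linear0.
have comb (c : 'I_(\rank N) -> K) :
    \sum_i c i *: f i = p (v ((\row_i c i) *m row_base N)).
  have -> : v ((\row_i c i) *m row_base N) = \sum_i c i *: v (row i (row_base N)).
    apply/esym; rewrite mulmx_sum_row.
    elim/big_rec2: _ => [|i x y _ ->]; first by rewrite /v trmx0.
    have -> (k : K) (y1 y2 : Y) (w1 w2 : 'cV[K]_r) :
      k *: (y1, w1) + (y2, w2) = (k *: y1 + y2, k *: w1 + w2) by [].
    by rewrite /v mxE scaler0 add0r linearD/= linearZ.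
  elim/big_rec2: _ => [|i x y _ ->]; first by rewrite p0.
  by rewrite [RHS]coker_piD; congr (_ + _); exact: coker_scale_pi.
apply: (dimension_basis R (e := f)); split=> [c|q].
  rewrite comb => /coker_pi_eq0[x]; rewrite TE => -[Lx Bx] i.
  have [d xE] := egen Lx.
  have Bxd : (B x)^T = (\row_j d j) *m char_mx.
    by rewrite -char_mxE xE; congr (B _)^T; apply: eq_bigr => j _; rewrite mxE.
  set w := _ *m _ in Bx.
  have : (w <= char_mx :&: N)%MS.
    rewrite sub_capmx; apply/andP; split.
      by rewrite -[w]trmxK -Bx Bxd submxMl.
    by apply: submx_trans (submxMl _ _) _; rewrite eq_row_base.
  rewrite capmx_compl submx0 => /eqP.
  rewrite -[X in _ = X](mul0mx _ (row_base N)) => /(row_free_inj (row_base_free N)).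
  by move/rowP => /(_ i); rewrite !mxE.
rewrite -[q]reprK; case: (repr q) => y w; rewrite -/p.
have [x Lx] := Lsurj y.
have : ((w - B x)^T <= char_mx + N)%MS by rewrite submx_full// addsmx_compl_full.
case/sub_addsmxP => -[u1 u2]/= wE.
have /submxP[c cE] : (u2 *m N <= row_base N)%MS by rewrite eq_row_base submxMl.
exists (fun i => c 0 i); rewrite comb.
have -> : \row_i c 0 i = c by apply/rowP => i; rewrite mxE.
rewrite -cE; set z := x + \sum_j u1 0 j *: e j.
have -> : (y, w) = T z + v (u2 *m N).
  have addE (y1 y2 : Y) (w1 w2 : 'cV[K]_r) :
    (y1, w1) + (y2, w2) = (y1 + y2, w1 + w2) by [].
  rewrite linearD T_kernel_comb TE /v !addE Lx !addr0; congr (_, _).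
  have -> : (u1 *m char_mx)^T = (w - B x) - (u2 *m N)^T.
    by rewrite -[w - B x]trmxK wE linearD/= addrK.
  by rewrite -addrA subrK addrC subrK.
rewrite /p coker_piD -/p -[RHS]add0r; congr (_ + _).
by apply/coker_pi_eq0; exists z.
Qed.

End FredholmReduction.

(** * Lower semicontinuity of the rank *)

Section RankSemicontinuity.
Variable K : numFieldType.

(** If v N = 0 then v = - v (N - 1), and summing the absolute values of the
    coordinates gives |v| <= d n |v| with d n < 1. *)
Lemma row_free_near_1 n (N : 'M[K]_n) (d : K) : d *+ n < 1 ->
  (forall i j, `|N i j - (i == j)%:R| <= d) -> row_free N.
Proof.
move=> dn Nd; rewrite -kermx_eq0; apply/rowV0P => v /sub_kermxP vN.
have vE j : v 0 j = - \sum_i v 0 i * (N i j - (i == j)%:R).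
  have /rowP/(_ j) := vN; rewrite !mxE => vN0.
  under eq_bigr do rewrite mulrBr.
  rewrite sumrB vN0 sub0r opprK (bigD1 j)//= eqxx mulr1 big1 ?addr0// => i ij.
  by rewrite (negPf ij) mulr0.
pose S := \sum_j `|v 0 j|.
have S0 : 0 <= S by apply: sumr_ge0.
have : S <= (d *+ n) * S.
  rewrite {1}/S; apply: (@le_trans _ _ (\sum_(j < n) d * S)).
    apply: ler_sum => j _; rewrite vE normrN; apply: le_trans (ler_norm_sum _ _ _) _.
    rewrite /S mulr_sumr; apply: ler_sum => i _.
    by rewrite normrM mulrC ler_wpM2r.
  by rewrite sumr_const card_ord mulrnAl.
have [S0'|] := eqVneq S 0.
  move=> _; apply/rowP => j; rewrite mxE; apply/eqP; rewrite -normr_eq0.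
  by move/eqP: S0'; rewrite psumr_eq0// => /allP/(_ j); rewrite mem_index_enum; apply.
move=> Sn0; have {}S0 : 0 < S by rewrite lt_def Sn0.
by rewrite -{1}[S]mul1r ler_pM2r// => /le_lt_trans/(_ dn); rewrite ltxx.
Qed.

(** With P M Q the identity of size rank M, a small change of M keeps P M Q
    invertible. *)
Lemma rank_near m r (M : 'M[K]_(m, r)) : exists2 d : K, 0 < d &
  forall N : 'M[K]_(m, r), (forall i j, `|N i j - M i j| <= d) ->
  (\rank M <= \rank N)%N.
Proof.
set k := \rank M.
have [P [Q PMQ]] : exists (P : 'M[K]_(k, m)) (Q : 'M[K]_(r, k)),
    P *m M *m Q = 1%:M.
  exists (pid_mx k *m invmx (col_ebase M)), (invmx (row_ebase M) *m pid_mx k).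
  rewrite -{2}[M]mulmx_ebase -!mulmxA (mulmxA (invmx (col_ebase M))).
  rewrite mulVmx ?col_ebase_unit// mul1mx (mulmxA (row_ebase M)).
  rewrite mulmxV ?row_ebase_unit// mul1mx -/k.
  rewrite pid_mx_id ?rank_leq_col// pid_mx_id ?rank_leq_row//.
  by rewrite pid_mx_1.
pose S := 1 + \sum_(i < k) \sum_(j < k) \sum_(p < r) \sum_(q < m) `|P i q| * `|Q p j|.
have S0 : 0 < S.
  rewrite ltr_pwDl// sumr_ge0// => i _; rewrite sumr_ge0// => j _.
  by rewrite sumr_ge0// => p _; rewrite sumr_ge0// => q _; rewrite mulr_ge0.
exists (S^-1 / k.+1%:R); first by rewrite divr_gt0 ?invr_gt0.
set d := _ / _ => N NM.
have d0 : 0 <= d by rewrite divr_ge0 ?invr_ge0 ?ltW.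
have /eqP <- : row_free (P *m N *m Q).
  apply: (@row_free_near_1 _ _ (S * d)).
    rewrite /d mulrA mulfV ?gt_eqF// mul1r.
    by rewrite -[ltLHS]mulr_natr mulrC ltr_pdivrMr ?mul1r ?ltr_nat// ltr0n.
  move=> i j.
  have -> : (P *m N *m Q) i j - (i == j)%:R = (P *m (N - M) *m Q) i j.
    by rewrite mulmxBr mulmxBl PMQ !mxE.
  rewrite !mxE; apply: le_trans (ler_norm_sum _ _ _) _.
  apply: (@le_trans _ _ (\sum_(p < r) \sum_(q < m) `|P i q| * `|Q p j| * d)).
    apply: ler_sum => p _; rewrite normrM mxE.
    rewrite mulrC; apply: le_trans (ler_wpM2l (normr_ge0 _) (ler_norm_sum _ _ _)) _.
    rewrite mulr_sumr; apply: ler_sum => q _; rewrite !mxE normrM mulrA.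
    by rewrite [`|Q _ _| * _]mulrC ler_wpM2l ?mulr_ge0.
  rewrite /S mulrDl mul1r.
  rewrite -[leLHS]add0r lerD//.
  under eq_bigr do rewrite -mulr_suml.
  rewrite -mulr_suml ler_wpM2r// (bigD1 i)//= (bigD1 j)//= -addrA lerDl.
  rewrite addr_ge0// sumr_ge0// => i' _; last (rewrite sumr_ge0// => j' _).
    by rewrite sumr_ge0// => p _; rewrite sumr_ge0// => q _; rewrite mulr_ge0.
  by rewrite sumr_ge0// => p _; rewrite sumr_ge0// => q _; rewrite mulr_ge0.
by rewrite (leq_trans (mxrankM_maxl _ _))// mxrankM_maxr.
Qed.

End RankSemicontinuity.

(** * Completeness, contractions and uniform boundedness *)

Section RealNorm.
Local Open Scope complex_scope.
Variables (R : realType) (V : normedModType R[i]).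
Implicit Types x y z : V.

(** The norms take their values in R[i], whose order is partial; all estimates
    are carried out in R instead. *)
Definition rnorm x : R := complex.Re `|x|.

Lemma rnormE x : `|x| = (rnorm x)%:C.
Proof.
have : 0 <= `|x| by exact: normr_ge0.
rewrite /rnorm; case: (`|x|) => u v; rewrite lecE/= => /andP[/eqP -> _].
by [].
Qed.

Lemma rnorm_ge0 x : 0 <= rnorm x.
Proof. by rewrite -lecR -rnormE normr_ge0. Qed.

Lemma rnormD x y : rnorm (x + y) <= rnorm x + rnorm y.
Proof. by rewrite -lecR rmorphD/= -!rnormE ler_normD. Qed.

Lemma rnormN x : rnorm (- x) = rnorm x.
Proof. by rewrite /rnorm normrN. Qed.

Lemma rnorm_distC x y : rnorm (x - y) = rnorm (y - x).
Proof. by rewrite /rnorm distrC. Qed.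

Lemma rnorm_distD z x y : rnorm (x - y) <= rnorm (x - z) + rnorm (z - y).
Proof. by rewrite -[x - y](subrKA z) rnormD. Qed.

Lemma rnorm0 : rnorm 0 = 0.
Proof. by rewrite /rnorm normr0. Qed.

Lemma rnormZ c x : rnorm (c *: x) = normc c * rnorm x.
Proof.
by apply: (@complexI R); rewrite -rnormE normrZ rnormE rmorphM.
Qed.

Lemma rnorm_eq0 x : rnorm x = 0 -> x = 0.
Proof. by move=> x0; apply/eqP; rewrite -normr_eq0 rnormE x0. Qed.

Lemma rnorm_sum (I : Type) (s : seq I) (P : pred I) (F : I -> V) :
  rnorm (\sum_(i <- s | P i) F i) <= \sum_(i <- s | P i) rnorm (F i).
Proof.
elim/big_rec2: _ => [|i y x _ h]; first by rewrite rnorm0.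
by apply: le_trans (rnormD _ _) _; rewrite lerD2l.
Qed.

Lemma rnorm_cvgP (T : Type) (F : set_system T) {FF : Filter F}
    (u : T -> V) (l : V) :
  u x @[x --> F] --> l <->
  forall e : R, 0 < e -> \forall x \near F, rnorm (l - u x) < e.
Proof.
split=> [/cvgrPdist_lt ul e e0|h].
  have := ul e%:C; rewrite ltcR => /(_ e0); apply: filterS => n.
  by rewrite rnormE ltcR.
apply/cvgrPdist_lt => e; rewrite ltcE/= => /andP[/eqP Ime Ree].
apply: filterS (h _ Ree) => n; rewrite rnormE ltcE/= Ime eqxx/=; exact.
Qed.

(** Completeness tested on geometrically fast Cauchy sequences, the only ones
    that the iterations below produce. *)
Definition banach := forall (u : nat -> V) (C : R),
  (forall n, rnorm (u n.+1 - u n) <= C * 2^-1 ^+ n) ->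
  exists (l : V) (D : R), forall n, rnorm (l - u n) <= D * 2^-1 ^+ n.

End RealNorm.

Lemma rnormc (R : realType) (z : R[i]) : rnorm z = normc z.
Proof. by []. Qed.

Lemma normc_real (R : realType) (r : R) : normc (r%:C)%C = `|r|.
Proof. by rewrite /= expr0n/= addr0 sqrtr_sqr. Qed.

(** The closing step of estimates that hold up to a geometric error. *)
Lemma geom_le0 (R : realType) (x D : R) :
  (forall n, x <= D * 2^-1 ^+ n) -> x <= 0.
Proof.
move=> xD; rewrite leNgt; apply/negP => x0.
have h : D * 2^-1 ^+ n @[n --> \oo] --> (0 : R).
  rewrite -[0](mulr0 D); apply: cvgMr; apply: cvg_expr.
  by rewrite ger0_norm// invf_lt1// ltr1n.
have /cvgrPdist_lt/(_ _ x0)[N _ /(_ N (leqnn _))] := h.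
rewrite sub0r normrN => /ltr_normlW; rewrite ltNge xD//.
Qed.

Section BanachTheorems.
Local Open Scope complex_scope.
Variables (R : realType) (V : normedModType R[i]).
Hypothesis bV : banach V.

Lemma contraction_fixed_point (K : V -> V) :
  (forall x y, rnorm (K x - K y) <= 2^-1 * rnorm (x - y)) ->
  exists x, x = K x.
Proof.
move=> Kc; pose u n := iter n K 0.
have uC n : rnorm (u n.+1 - u n) <= rnorm (u 1%N - u 0%N) * 2^-1 ^+ n.
  elim: n => [|n ih]; first by rewrite mulr1.
  apply: le_trans (Kc _ _) _.
  by rewrite exprS mulrCA ler_wpM2l.
have [l [D lD]] := bV uC; exists l.
apply/eqP; rewrite -subr_eq0; apply/eqP/rnorm_eq0/eqP.
rewrite eq_le rnorm_ge0 andbT; apply: (geom_le0 (D := D)) => n.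
apply: le_trans (rnorm_distD (u n.+1) _ _) _.
have h1 := lD n.+1; have h2 : rnorm (u n.+1 - K l) <= _ := Kc (u n) l.
have h3 := lD n; rewrite rnorm_distC in h3.
move: h1 h2 h3; rewrite exprS mulrCA; move: (D * _) => p h1 h2 h3; lra.
Qed.

Variables (W : normedModType R[i]) (I : Type) (phi : I -> V -> W).
Hypothesis philin : forall i, linear (phi i).

(** A gliding-hump argument. If no uniform bound exists, the family is unbounded
    on every ball; as each operator is bounded, hence continuous, one can choose
    nested balls and, for the n-th, an operator exceeding n throughout it. At the common point
    of these balls the family is not bounded. *)
Lemma uniform_boundedness :
  (forall i, exists C, forall x, rnorm (phi i x) <= C * rnorm x) ->
  (forall x, exists M, forall i, rnorm (phi i x) <= M) ->
  exists2 C : R, 0 <= C & forall i x, rnorm (phi i x) <= C * rnorm x.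
Proof.
move=> phib phip.
have phiB i x y : phi i (x - y) = phi i x - phi i y.
  by rewrite addrC -scaleN1r philin scaleN1r addrC.
have phi0 i : phi i 0 = 0 by rewrite -(subrr 0) phiB subrr.
have phiZ i c x : phi i (c *: x) = c *: phi i x.
  by have := philin i c x 0; rewrite phi0 !addr0.
apply: contrapT => nub.
have big (x : V) (r M : R) : 0 < r ->
    exists i y, rnorm (y - x) <= r /\ M < rnorm (phi i y).
  move=> r0; apply: contrapT => nbig.
  have small i y : rnorm (y - x) <= r -> rnorm (phi i y) <= M.
    by move=> yr; rewrite leNgt; apply/negP => My; apply: nbig; exists i, y.
  have M0 (i : I) : 0 <= M.
    by apply: (le_trans (rnorm_ge0 (phi i x))); apply: small; rewrite subrr rnorm0 ltW.
  have ball0 i h : rnorm h <= r -> rnorm (phi i h) <= 2 * M.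
    move=> hr; have -> : h = (x + h) - x by rewrite addrC addKr.
    rewrite phiB; apply: le_trans (rnormD _ _) _; rewrite rnormN mulr_natl mulr2n.
    apply: lerD; apply: small; first by rewrite addrC addKr.
    by rewrite subrr rnorm0 ltW.
  apply: nub; exists (2 * Num.max M 0 / r).
    by rewrite divr_ge0 ?mulr_ge0 ?le_max ?lexx ?orbT// ltW.
  move=> i z; have [->|z0] := eqVneq z 0.
    by rewrite phi0 !rnorm0 mulr0.
  have z1 : 0 < rnorm z.
    rewrite lt_def rnorm_ge0 andbT; apply: contra_neq z0; exact: rnorm_eq0.
  pose c := r / rnorm z.
  have c0 : 0 < c by rewrite divr_gt0.
  have nc : normc c%:C = c by rewrite normc_real gtr0_norm.
  have := ball0 i (c%:C *: z).
  rewrite phiZ !rnormZ nc divfK ?gt_eqF// lexx => /(_ isT).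
  rewrite -ler_pdivlMl// => /le_trans; apply.
  by rewrite (max_idPl (M0 i)) /c invf_div mulrC [rnorm z / r]mulrC mulrA lexx.
(* A pair p stands for the ball of centre p.1 and radius p.2. *)
have step (p : V * R) (M : nat) : exists q : (V * R) * I, 0 < p.2 ->
    [/\ 0 < q.1.2, rnorm (q.1.1 - p.1) <= p.2 / 2, q.1.2 <= p.2 / 2 &
        forall y, rnorm (y - q.1.1) <= q.1.2 -> M%:R < rnorm (phi q.2 y)].
  have [p0|] := boolP (0 < p.2); last first.
    by exists (p, sval (cid (big 0 1 0 ltr01))).
  have [i [y [yx My]]] := big p.1 (p.2 / 2) M%:R (divr_gt0 p0 (ltr0Sn _ _)).
  have [C Cb] := phib i.
  pose d := (rnorm (phi i y) - M%:R) / 2 / (`|C| + 1).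
  have C0 : 0 < `|C| + 1 by rewrite ltr_pwDr.
  have d0 : 0 < d by rewrite !divr_gt0// subr_gt0.
  exists ((y, Num.min (p.2 / 2) d), i) => _ /=; split => //.
  - by rewrite lt_min d0 divr_gt0.
  - by rewrite ge_min lexx.
  move=> z; rewrite le_min => /andP[_ zd].
  have : rnorm (phi i (y - z)) <= (rnorm (phi i y) - M%:R) / 2.
    apply: le_trans (Cb _) _; rewrite rnorm_distC.
    apply: le_trans (ler_wpM2r (rnorm_ge0 _) (ler_norm C)) _.
    have -> : (rnorm (phi i y) - M%:R) / 2 = (`|C| + 1) * d.
      by rewrite /d [RHS]mulrC divfK// gt_eqF.
    by apply: ler_pM => //; rewrite ?rnorm_ge0// lerDl.
  rewrite phiB; have := rnorm_distD (phi i z) (phi i y) 0.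
  rewrite !subr0; lra.
have [f fP] := choice (fun pM : (V * R) * nat => step pM.1 pM.2).
pose p : nat -> V * R := fix p n := if n is n'.+1 then (f (p n', n')).1 else (0, 1).
have p0 n : 0 < (p n).2.
  by elim: n => [//|n ih]; have [] := fP (p n, n) ih.
have pP n := fP (p n, n) (p0 n).
have p2 n : (p n).2 <= 2^-1 ^+ n.
  elim: n => [//|n ih]; have [_ _ + _] := pP n; rewrite exprS /=; lra.
have pC n : rnorm ((p n.+1).1 - (p n).1) <= 1 * 2^-1 ^+ n.
  have [_ + _ _] := pP n; have := p2 n; have := p0 n; rewrite mul1r /=; lra.
have [l [D lD]] := bV pC.
have nested n k : rnorm ((p (k + n)%N).1 - (p n).1) <= (p n).2 - (p (k + n)%N).2.
  elim: k => [|k ih]; first by rewrite add0n !subrr rnorm0.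
  have [_ h1 h2 _] := pP (k + n)%N; rewrite addSn.
  have := rnorm_distD (p (k + n)%N).1 (p (k + n).+1).1 (p n).1.
  by move: h1 h2 ih => /=; lra.
have lp n : rnorm (l - (p n).1) <= (p n).2.
  rewrite -subr_le0; apply: (geom_le0 (D := D)) => k.
  have := rnorm_distD (p (k + n)%N).1 l (p n).1.
  have := nested n k; have := p0 (k + n)%N.
  have D0 : 0 <= D by have := lD 0%N; rewrite mulr1; apply: le_trans; exact: rnorm_ge0.
  have : D * 2^-1 ^+ (k + n) <= D * 2^-1 ^+ k.
    rewrite ler_wpM2l// exprD ler_piMr ?exprn_ge0// exprn_ile1//; lra.
  have := lD (k + n)%N; lra.
have [M lM] := phip l.
have [N MN] : exists N : nat, M <= N%:R.
  exists (Num.bound `|M|); apply: le_trans (ler_norm M) (ltW (archi_boundP _)).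
  exact: normr_ge0.
have [_ _ _ h] := pP N; have := h l (lp N.+1).
by rewrite ltNge => /negP; apply; exact: le_trans (lM _) MN.
Qed.

End BanachTheorems.

(** * Calculus on a segment *)

Section Segment.
Local Open Scope complex_scope.
Variables (R : realType) (a b : R) (ab : a < b).
Local Notation I := (`[a, b]%classic).
Let seg_proper (t : I) : ProperFilter t^' := seg_dnbhs_proper ab t.
#[local] Existing Instance seg_proper.

Lemma Re_continuous : continuous (@complex.Re R).
Proof.
move=> u; apply/(@cvgrPdist_lt R R _ (nbhs u) (nbhs_filter u)) => e e0.
apply/nbhs_ballP; exists (e%:C) => /=; first by rewrite ltcR.
move=> v /= uv; rewrite -ltcR; apply: le_lt_trans uv.
by rewrite -raddfB normc_ge_Re.
Qed.

Lemma normc_ge_Im (z : R[i]) : `|complex.Im z|%:C <= `|z|.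
Proof.
have -> : `|z| = `|z * 'i|.
  by rewrite normrM [`|'i|]normc_def/= expr0n expr1n/= add0r sqrtr1 mulr1.
by apply: le_trans (normc_ge_Re _); rewrite ReiNIm normrN.
Qed.

Lemma Im_continuous : continuous (@complex.Im R).
Proof.
move=> u; apply/(@cvgrPdist_lt R R _ (nbhs u) (nbhs_filter u)) => e e0.
apply/nbhs_ballP; exists (e%:C) => /=; first by rewrite ltcR.
move=> v /= uv; rewrite -ltcR; apply: le_lt_trans uv.
by rewrite -raddfB normc_ge_Im.
Qed.

(** Composing with the projection of the line onto the segment extends functions
    on the segment to the line, where real calculus applies. *)
Fact clamp_subproof u : Num.max a (Num.min b u) \in I.
Proof. by rewrite inE/= in_itv/= ge_max (ltW ab) le_max lexx ge_min lexx. Qed.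

Definition clamp u : I :=
  exist _ (Num.max a (Num.min b u)) (clamp_subproof u).

Lemma val_clamp u : a <= u <= b -> val (clamp u) = u.
Proof. by case/andP => au ub /=; rewrite (min_idPr ub) (max_idPr au). Qed.

Lemma seg_itv (t : I) : a <= val t <= b.
Proof. by have := set_valP t; rewrite /= in_itv. Qed.

Lemma clampK : cancel val clamp.
Proof. by move=> t; apply: val_inj; rewrite val_clamp// seg_itv. Qed.

Lemma clamp_continuous : continuous clamp.
Proof.
apply: continuous_comp_initial => u /=.
apply: (@continuous_max _ _ (fun=> a)); first exact: cvg_cst.
by apply: (@continuous_min _ _ (fun=> b)); [exact: cvg_cst|exact: cvg_id].
Qed.

Lemma val_dnbhs (t : I) : val s - val t @[s --> t^'] --> (0 : R)^'.
Proof.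
have vt : val s - val t @[s --> t^'] --> (0 : R).
  rewrite -(subrr (val t)); apply: cvgB; last exact: cvg_cst.
  apply: cvg_trans; last exact: (@initial_continuous I R set_val t).
  exact: cvg_app (@cvg_within _ _ _ _).
move=> A /vt/=; rewrite /nbhs/= /dnbhs /within/=.
move=> h; apply: filterS h => s + st; apply => //.
by apply: contra_neq st => /subr0_eq st; exact: val_inj.
Qed.

Lemma is_deriv_itv_restrict (F G : R -> R) (f g : R) (t : I) :
  is_derive (val t) 1 F f -> is_derive (val t) 1 G g ->
  is_deriv_itv (fun s : I => F (val s) +i* G (val s)) t (f +i* g).
Proof.
have quot (H : R -> R) h : is_derive (val t) 1 H h ->
    ((val s - val t)^-1 * (H (val s) - H (val t)))%:C @[s --> t^'] --> h%:C.
  move=> dH; have Hh : (fun e => e^-1 *: (H (e + val t) - H (val t))) @ 0^' --> h.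
    have /cvg_ex[l Hl] := @ex_derive _ _ _ _ _ _ _ dH.
    suff <- : l = h.
      move: Hl; apply: cvg_trans; apply: near_eq_cvg.
      by apply: nearW => e /=; rewrite [e *: 1]mulr1.
    rewrite -(@derive_val _ _ _ _ _ _ _ dH); apply/esym.
    by apply: cvg_lim; [exact: Rhausdorff|exact: Hl].
  suff qh : (val s - val t)^-1 * (H (val s) - H (val t)) @[s --> t^'] --> h.
    exact: (cvg_comp _ _ qh (@real_complex_continuous R h)).
  have := cvg_comp _ _ (@val_dnbhs t) Hh; apply: cvg_trans.
  by apply: near_eq_cvg; apply: nearW => s /=; rewrite subrK.
move=> /quot Ff /quot Gg.
rewrite /is_deriv_itv; have -> : f +i* g = f%:C + 'i * g%:C by rewrite [LHS]complexE.
rewrite (_ : diff_quot _ _ = fun s =>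
    ((val s - val t)^-1 * (F (val s) - F (val t)))%:C +
    'i * ((val s - val t)^-1 * (G (val s) - G (val t)))%:C).
  exact: (cvgD Ff (cvgM (cvg_cst _) Gg)).
apply/funext => s; rewrite /diff_quot -fmorphV/=; apply/eqP; rewrite eq_complex/=.
by rewrite !(mul0r, mul1r, mulr0, subr0, add0r, addr0) !eqxx.
Qed.

Lemma is_deriv_itv_cst (c : R[i]) (t : I) :
  is_deriv_itv ((fun=> c) : I -> R[i]) t 0.
Proof.
rewrite /is_deriv_itv (_ : diff_quot _ _ = cst 0); first exact: cvg_cst.
by apply/funext => s; rewrite /diff_quot subrr mulr0.
Qed.

Lemma is_derive_Re_clamp (x : I -> R[i]) (u : R) : differentiable_itv x ->
  a < u < b ->
  is_derive u 1 (fun v => complex.Re (x (clamp v)))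
    (complex.Re (deriv_itv x (clamp u))).
Proof.
move=> dx /andP[au ub]; set f := fun _ => _; set l := complex.Re _.
have cu : val (clamp u) = u by rewrite val_clamp// !ltW.
have tou : h + u @[h --> (0 : R)] --> u.
  by rewrite -[X in _ --> X]add0r; apply: cvgD; [exact: cvg_id|exact: cvg_cst].
have nearI : \forall h \near (0 : R), a < h + u < b.
  have uab : u \in `]a, b[%R by rewrite in_itv/= au ub.
  have := tou _ (near_in_itvoo uab).
  by rewrite nbhs_simpl /=; apply: filterS => h; rewrite /= in_itv.
have todn : clamp (h + u) @[h --> (0 : R)^'] --> (clamp u)^'.
  move=> A nA; have nA' : \forall h \near (0 : R),
    clamp (h + u) != clamp u -> A (clamp (h + u)).
    exact: (cvg_comp _ _ tou (@clamp_continuous u) _ nA).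
  suff : \forall h \near (0 : R), h != 0 -> A (clamp (h + u)) by [].
  near=> h => h0; have : clamp (h + u) != clamp u -> A (clamp (h + u)) by near: h.
  apply; apply: contra_neq h0 => /(congr1 val).
  have /andP[h1 h2] : a < h + u < b by near: h.
  rewrite cu val_clamp ?(ltW h1) ?(ltW h2)// => /eqP.
  by rewrite -subr_eq0 addrK => /eqP.
have fl : h^-1 *: ((f \o shift u) (h *: 1) - f u) @[h --> (0 : R)^'] --> l.
  have := cvg_comp _ _ (cvg_comp _ _ todn (@differentiable_itvP _ _ _ x (clamp u) dx))
    (@Re_continuous _).
  apply: cvg_trans; apply: near_eq_cvg.
  suff : \forall h \near (0 : R), h != 0 ->
    complex.Re (diff_quot x (clamp u) (clamp (h + u))) =
    h^-1 *: ((f \o shift u) (h *: 1) - f u) by [].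
  near=> h => h0 /=; have /andP[h1 h2] : a < h + u < b by near: h.
  rewrite [h *: 1]mulr1 /diff_quot cu val_clamp ?(ltW h1) ?(ltW h2)// addrK.
  by rewrite -fmorphV/= /f; case: (x _) => ? ?; case: (x _) => ? ?/=; rewrite mul0r subr0.
by apply: DeriveDef; [apply/cvg_ex; exists l|apply: cvg_lim; first exact: Rhausdorff].
Unshelve. all: by end_near. Qed.

Lemma mean_value_Re (x : I -> R[i]) (g g' : R -> R) : differentiable_itv x ->
  (forall u : R, is_derive u (1 : R) g (g' u)) ->
  (forall t : I, complex.Re (deriv_itv x t) <= g' (val t)) ->
  forall t, complex.Re (x t - x (clamp a)) <= g (val t) - g a.
Proof.
move=> dx dg xg t.
have [ta|] := eqVneq (val t) a.
  have tE : t = clamp a by rewrite -[LHS]clampK ta.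
  by rewrite {1}tE !subrr ta subrr.
have /andP[at_ tb] := seg_itv t.
move=> ta; have {at_ ta} at_ : a < val t by rewrite lt_def ta.
pose h u := complex.Re (x (clamp u)) - g u.
have [||c] := @MVT R h (fun u => complex.Re (deriv_itv x (clamp u)) - g' u) a (val t) at_.
- move=> u; rewrite in_itv/= => /andP[au ut]; apply: is_deriveB.
  by apply: is_derive_Re_clamp => //; rewrite au (lt_le_trans ut).
- apply: continuous_subspaceT => u; apply: cvgB.
    have cx := Defs.differentiable_continuous dx.
    exact: (cvg_comp _ _ (cvg_comp _ _ (@clamp_continuous u) (cx _)) (@Re_continuous _)).
  by apply: derive.differentiable_continuous; apply/derivable1_diffP.
rewrite in_itv/= => /andP[ac ct].
rewrite /h clampK raddfB/= => hE.
have : (complex.Re (deriv_itv x (clamp c)) - g' c) * (val t - a) <= 0.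
  rewrite mulr_le0_ge0 ?subr_ge0 ?(ltW at_)// subr_le0.
  apply: le_trans (xg _) _; rewrite val_clamp// (ltW ac)/=.
  exact: ltW (lt_le_trans ct tb).
rewrite -hE; lra.
Qed.

(** Multiplying x by a unimodular constant makes x t - x a real and
    nonnegative, and the real mean value inequality applies. *)
Lemma mean_value_normc (x : I -> R[i]) (g g' : R -> R) : differentiable_itv x ->
  (forall u : R, is_derive u (1 : R) g (g' u)) ->
  (forall t : I, normc (deriv_itv x t) <= g' (val t)) ->
  forall t, normc (x t - x (clamp a)) <= g (val t) - g a.
Proof.
move=> dx dg xg t; set d := x t - _.
have [d0|d0] := eqVneq d 0.
  have g0 : forall s : I, complex.Re (deriv_itv (0 : I -> R[i]) s) <= g' (val s).
    move=> s; have [_ ->] := deriv_itv0 ab; apply: le_trans (xg s).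
    exact: normc_ge0.
  have [dz _] := deriv_itv0 ab.
  by rewrite d0 normc0; apply: le_trans (mean_value_Re dz dg g0 t); rewrite subrr.
have nd : normc d != 0 by apply: contra_neq d0; exact: eq0_normc.
(* The unimodular constant that rotates d onto the positive half-line. *)
pose c := (normc d)%:C / d.
have nc : normc c = 1.
  by rewrite /c normcM normcV normc_real ger0_norm ?normc_ge0// mulfV.
have [d00 d0E] := deriv_itv0 ab.
have dcx := differentiable_itvD (c := c) dx d00.
have cg s : complex.Re (deriv_itv (c *: x + 0) s) <= g' (val s).
  rewrite (deriv_itvD ab c dx d00) d0E addr0; apply: le_trans (xg s).
  rewrite -[leRHS]mul1r -nc -normcM.
  apply: le_trans (ler_norm _) _; rewrite -lecR.
  exact: normc_ge_Re.
have := mean_value_Re dcx dg cg t.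
rewrite addr0/= /GRing.scale/= -mulrBr -/d /c.
by rewrite divfK.
Qed.

Lemma deriv_itv_eq0_cst (x : I -> R[i]) : differentiable_itv x ->
  deriv_itv x = 0 -> forall t, x t = x (clamp a).
Proof.
move=> dx x0 t; apply/eqP; rewrite -subr_eq0; apply/eqP/eq0_normc/eqP.
rewrite eq_le normc_ge0 andbT.
have d0 (u : R) : is_derive u (1 : R) (cst (0 : R)) ((cst 0 : R -> R) u).
  exact: is_derive_cst.
have := mean_value_normc dx d0 _ t; rewrite subrr; apply => s.
by rewrite x0 normc0.
Qed.

(** The integral starts at a - 1 so that a is an interior point, where the
    fundamental theorem of calculus gives a two-sided derivative. *)
Lemma real_primitive (f : R -> R) : continuous f ->
  exists F : R -> R, forall u, a <= u <= b -> is_derive u (1 : R) F (f u).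
Proof.
move=> cf; exists (fun u => \int[lebesgue_measure]_(t in `[a - 1, u]) f t)%R.
move=> u /andP[au ub].
have ub1 : u < b + 1 by rewrite (le_lt_trans ub)// ltrDl.
have au1 : a - 1 < u by rewrite (lt_le_trans _ au)// gtrBl.
have fint : lebesgue_measure.-integrable `[a - 1, b + 1] (EFin \o f).
  apply: continuous_compact_integrable; first exact: segment_compact.
  exact: continuous_subspaceT.
have [dF FE] := continuous_FTC1_closed ub1 fint au1 (cf u).
by split; [exact: dF|rewrite -derive1E; exact: FE].
Qed.

Lemma primitive_exists (x : I -> R[i]) : continuous x -> exists y : I -> R[i],
  [/\ differentiable_itv y, deriv_itv y = x & y (clamp a) = 0].
Proof.
move=> cx.
have cxc u : x (clamp v) @[v --> u] --> x (clamp u).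
  exact: (cvg_comp _ _ (@clamp_continuous u) (cx _)).
have [F dF] : exists F : R -> R, forall u, a <= u <= b ->
    is_derive u (1 : R) F (complex.Re (x (clamp u))).
  apply: (real_primitive (f := fun u => complex.Re (x (clamp u)))) => u.
  exact: (cvg_comp _ _ (cxc u) (@Re_continuous _)).
have [G dG] : exists G : R -> R, forall u, a <= u <= b ->
    is_derive u (1 : R) G (complex.Im (x (clamp u))).
  apply: (real_primitive (f := fun u => complex.Im (x (clamp u)))) => u.
  exact: (cvg_comp _ _ (cxc u) (@Im_continuous _)).
pose y0 (s : I) := F (val s) +i* G (val s).
have dy0 t : is_deriv_itv y0 t (x t).
  have := is_deriv_itv_restrict (dF _ (seg_itv t)) (dG _ (seg_itv t)).
  by rewrite clampK; case: (x t).
pose cy : I -> R[i] := fun=> - y0 (clamp a).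
have dcy t : is_deriv_itv cy t 0 := is_deriv_itv_cst _ t.
have dy t : is_deriv_itv (1 *: y0 + cy) t (x t).
  by have := is_deriv_itv_lin (c := 1) (dy0 t) (dcy t); rewrite addr0 [1 *: x t]mul1r.
exists (1 *: y0 + cy); split.
- by move=> t; apply/cvg_ex; exists (x t); exact: dy.
- by apply/funext => t; apply: (is_deriv_itvE ab); exact: dy.
- by rewrite scale1r; exact: subrr.
Qed.

Definition primitive (x : I -> R[i]) : I -> R[i] :=
  xget 0 [set y | [/\ differentiable_itv y, deriv_itv y = x & y (clamp a) = 0]].

Lemma primitiveP x : continuous x -> [/\ differentiable_itv (primitive x),
  deriv_itv (primitive x) = x & primitive x (clamp a) = 0].
Proof.
move=> /primitive_exists[y yx]; rewrite /primitive.
by case: xgetP => [z _ //|/(_ y)].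
Qed.

Lemma primitive_deriv (y : I -> R[i]) : differentiable_itv y ->
  continuous (deriv_itv y) ->
  forall t, y t = y (clamp a) + primitive (deriv_itv y) t.
Proof.
move=> dy cy t; have [dp pE pa] := primitiveP cy.
set p := primitive _ in dp pE pa *.
have dd := differentiable_itvD (c := -1) dp dy.
have d0 : deriv_itv (-1 *: p + y) = 0.
  by rewrite (deriv_itvD ab _ dp dy) pE scaleN1r addNr.
have h : - p t + y t = - p (clamp a) + y (clamp a).
  by have := deriv_itv_eq0_cst dd d0 t; rewrite scaleN1r.
by rewrite pa oppr0 add0r in h; rewrite -h addrAC addNr add0r.
Qed.

Lemma primitive_unique (x y : I -> R[i]) : continuous x ->
  differentiable_itv y -> deriv_itv y = x -> y (clamp a) = 0 -> y = primitive x.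
Proof.
move=> + dy yE ya; rewrite -yE => cy; apply/funext => t.
by rewrite (primitive_deriv dy cy) ya add0r.
Qed.

Lemma primitive_linear c x y : continuous x -> continuous y ->
  primitive (c *: x + y) = c *: primitive x + primitive y.
Proof.
move=> cx cy; have [dpx pxE pxa] := primitiveP cx.
have [dpy pyE pya] := primitiveP cy.
apply/esym/primitive_unique.
- exact: (cont_diffD ab c (l := 0) cx cy).
- exact: differentiable_itvD.
- by rewrite (deriv_itvD ab)// pxE pyE.
- by rewrite -[LHS]/(c * primitive x (clamp a) + primitive y (clamp a)) pxa pya mulr0 addr0.
Qed.

Lemma cont_diff_primitive l x : cont_diff l x -> cont_diff l.+1 (primitive x).
Proof.
move=> cx; have [dp pE _] := primitiveP (cont_diff_continuous cx).
by split => //; rewrite pE.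
Qed.

(** The factor 1 / lam gained here is what makes the Volterra operator a
    contraction for the weighted norm. *)
Lemma primitive_weighted (x : I -> R[i]) (M lam : R) : continuous x ->
  0 <= M -> 0 < lam ->
  (forall t : I, normc (x t) <= M * expR (lam * (val t - a))) ->
  forall t : I, normc (primitive x t) <= M / lam * expR (lam * (val t - a)).
Proof.
move=> cx M0 lam0 xM t; have [dp pE pa] := primitiveP cx.
pose g (u : R) := M / lam * expR (lam * (u - a)).
pose g' (u : R) := M * expR (lam * (u - a)).
have dg u : is_derive u (1 : R) g (g' u).
  have dl : is_derive u (1 : R) (fun u : R => lam * (u - a)) lam.
    have : is_derive u (1 : R) (lam \*: ((id : R -> R) - cst a)) (lam *: (1 - 0)).
      by apply: is_deriveZ; apply: is_deriveB.
    by rewrite subr0 [lam *: 1]mulr1.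
  have de := @is_derive1_comp _ expR (fun u : R => lam * (u - a)) _ _ _
    (is_derive_expR (lam * (u - a))) dl.
  have : is_derive u (1 : R) ((M / lam) \*: (expR \o (fun u : R => lam * (u - a))))
      ((M / lam) *: (expR (lam * (u - a)) * lam)).
    exact: is_deriveZ.
  suff -> : (M / lam) *: (expR (lam * (u - a)) * lam) = g' u by [].
  by rewrite /g' /GRing.scale/=; field; rewrite gt_eqF.
have := mean_value_normc dp dg _ t; rewrite pE pa subr0 => /(_ xM).
move=> /le_trans; apply; rewrite gerBl /g mulr_ge0 ?expR_ge0//.
by rewrite divr_ge0// ltW.
Qed.

End Segment.

(** * Completeness of the spaces of differentiable functions *)

Section FastCauchy.
Local Open Scope complex_scope.
Variable R : realType.

(** The intervals of centre v n and radius 2 C 2^-n are nested. *)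
Lemma real_fast_cauchy (v : nat -> R) (C : R) :
  (forall n, `|v n.+1 - v n| <= C * 2^-1 ^+ n) ->
  exists l, forall n, `|l - v n| <= 2 * C * 2^-1 ^+ n.
Proof.
move=> vC; pose d n : R := 2 * C * 2^-1 ^+ n.
have C0 : 0 <= C by have := vC 0%N; rewrite mulr1; apply: le_trans.
have d0 n : 0 <= d n by rewrite /d !mulr_ge0// exprn_ge0.
have dS n : d n = C * 2^-1 ^+ n + d n.+1.
  by rewrite /d exprS; field.
have lo n k : v n - d n <= v (k + n)%N - d (k + n)%N.
  elim: k => [//|k]; move/le_trans; apply; rewrite addSn [in leLHS]dS.
  have := vC (k + n)%N; rewrite ler_norml => /andP[+ _]; lra.
have hi n k : v (k + n)%N + d (k + n)%N <= v n + d n.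
  elim: k => [//|k]; apply: le_trans; rewrite addSn [in leRHS]dS.
  have := vC (k + n)%N; rewrite ler_norml => /andP[_ +]; lra.
have lohi k n : v k - d k <= v n + d n.
  apply: le_trans (hi n k); rewrite addnC; apply: le_trans (lo k n) _.
  have := d0 (n + k)%N; lra.
pose l := sup (range (fun n => v n - d n)).
exists l => n; rewrite ler_distl; apply/andP; split.
  apply: ub_le_sup; last by exists n.
  by exists (v 0%N + d 0%N) => _ [k _ <-].
apply: ge_sup; last by move=> _ [k _ <-].
by exists (v 0%N - d 0%N), 0%N.
Qed.

Lemma normc_Re_Im (z : R[i]) :
  normc z <= `|complex.Re z| + `|complex.Im z|.
Proof.
rewrite {1}[z]complexE; apply: le_trans (le_normcD _ _) _.
rewrite normcM !normc_real [normc 'i]/= expr0n expr1n/= add0r sqrtr1.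
by rewrite mul1r.
Qed.

Lemma complex_fast_cauchy (u : nat -> R[i]) (C : R) :
  (forall n, normc (u n.+1 - u n) <= C * 2^-1 ^+ n) ->
  exists l, forall n, normc (l - u n) <= 4 * C * 2^-1 ^+ n.
Proof.
move=> uC.
have [lr lrP] : exists l, forall n, `|l - complex.Re (u n)| <= 2 * C * 2^-1 ^+ n.
  apply: real_fast_cauchy => n; apply: le_trans (uC n).
  by rewrite -raddfB -lecR; exact: normc_ge_Re.
have [li liP] : exists l, forall n, `|l - complex.Im (u n)| <= 2 * C * 2^-1 ^+ n.
  apply: real_fast_cauchy => n; apply: le_trans (uC n).
  by rewrite -raddfB -lecR; exact: normc_ge_Im.
exists (lr +i* li) => n; apply: le_trans (normc_Re_Im _) _.
by have := lrP n; have := liP n; rewrite !raddfB/=; lra.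
Qed.

End FastCauchy.

Section Completeness.
Local Open Scope complex_scope.
Variables (R : realType) (a b : R) (ab : a < b).
Local Notation I := (`[a, b]%classic).
Let pta : I := clamp ab a.

Lemma Cl_norm0E (x : I -> R[i]) : Cl_norm 0 x = sup_norm x.
Proof. by rewrite /Cl_norm big_ord_recl big_ord0 addr0. Qed.

Lemma Cl_normS l (x : I -> R[i]) :
  Cl_norm l.+1 x = sup_norm x + Cl_norm l (deriv_itv x).
Proof.
by rewrite /Cl_norm big_ord_recl; congr (_ + _); apply: eq_bigr => i _; rewrite -iterSr.
Qed.

Lemma rnorm_Cl l (x : Cl ab l) : rnorm x = Cl_norm l (val x).
Proof. by []. Qed.

Lemma sup_norm_le_Cl l (x : I -> R[i]) : cont_diff l x ->
  sup_norm x <= Cl_norm l x.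
Proof.
case: l => [|l] cx; first by rewrite Cl_norm0E.
rewrite Cl_normS lerDl; apply: (Cl_norm_ge0 ab); exact: cont_diff_deriv cx.
Qed.

Lemma eval_le_Cl l (x : Cl ab l) (t : I) : normc (val x t) <= rnorm x.
Proof.
apply: le_trans (sup_norm_le_Cl (ClP x)).
exact: (sup_norm_ub ab t (cont_diff_continuous (ClP x))).
Qed.

Lemma cont_diff_cst l (c : R[i]) : cont_diff l ((fun=> c) : I -> R[i]).
Proof.
case: l => [|l]; first exact: cst_continuous.
have d t := is_deriv_itv_cst c t.
split; first by move=> t; apply/cvg_ex; exists 0; exact: d.
rewrite (_ : deriv_itv _ = 0); first exact: (cont_diff0 ab).
by apply/funext => t; apply: (is_deriv_itvE ab); exact: d.
Qed.

Definition Cl_cst l (c : R[i]) : Cl ab l := Cl_of ab (cont_diff_cst l c).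

Definition Cl_prim l (x : Cl ab l) : Cl ab l.+1 :=
  Cl_of ab (cont_diff_primitive ab (ClP x)).

Lemma Cl_deriv_cst l c : Cl_deriv (Cl_cst l.+1 c) = 0.
Proof.
apply: val_inj; apply/funext => t; apply: (is_deriv_itvE ab).
exact: is_deriv_itv_cst.
Qed.

Lemma Cl_deriv_prim l (x : Cl ab l) : Cl_deriv (Cl_prim x) = x.
Proof.
by apply: val_inj; have [] := primitiveP ab (cont_diff_continuous (ClP x)).
Qed.

Lemma Cl_prim_a l (x : Cl ab l) : val (Cl_prim x) pta = 0.
Proof. by have [] := primitiveP ab (cont_diff_continuous (ClP x)). Qed.

Lemma Cl_prim_deriv l (x : Cl ab l.+1) :
  x = Cl_cst l.+1 (val x pta) + Cl_prim (Cl_deriv x).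
Proof.
apply: val_inj; apply/funext => t; have [dx cx] := ClP x.
exact: (primitive_deriv ab dx (cont_diff_continuous cx)).
Qed.

Lemma sup_norm_primitive (x : I -> R[i]) : continuous x ->
  sup_norm (primitive ab x) <= expR (b - a) * sup_norm x.
Proof.
move=> cx; apply: (sup_norm_le ab) => t.
have e1 (s : I) : 1 <= expR (1 * (val s - a)).
  rewrite mul1r -expR0 ler_expR subr_ge0.
  by have /andP[] := seg_itv s.
have := @primitive_weighted _ _ _ ab x (sup_norm x) 1 cx (sup_norm_ge0 ab cx) ltr01.
move=> /(_ _ t)/le_trans; apply.
  move=> s; apply: le_trans (sup_norm_ub ab s cx) _.
  by rewrite ler_peMr// sup_norm_ge0.
rewrite divr1 mul1r mulrC ler_wpM2r ?sup_norm_ge0// ler_expR lerB//.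
by have /andP[] := seg_itv t.
Qed.

(** The norm of C^(l+1) is controlled by x(a) and the norm of x' in C^(l),
    since x is x(a) plus the primitive of x'. *)
Lemma Cl_norm_deriv_bound l (x : Cl ab l.+1) :
  rnorm x <= normc (val x pta) + (1 + expR (b - a)) * rnorm (Cl_deriv x).
Proof.
have [dx cx] := ClP x; have cdx := cont_diff_continuous cx.
rewrite rnorm_Cl Cl_normS mulrDl mul1r.
suff : sup_norm (val x) <=
    normc (val x pta) + expR (b - a) * rnorm (Cl_deriv x).
  by rewrite rnorm_Cl/=; lra.
apply: (sup_norm_le ab) => t; rewrite (primitive_deriv ab dx cdx).
apply: le_trans (le_normcD _ _) _; rewrite lerD2l.
have [dp _ _] := primitiveP ab cdx.
apply: le_trans (sup_norm_ub ab t (Defs.differentiable_continuous dp)) _.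
apply: le_trans (sup_norm_primitive cdx) _.
by rewrite ler_wpM2l ?expR_ge0//; exact: (sup_norm_le_Cl cx).
Qed.

Lemma rnorm_deriv_le l (x : Cl ab l.+1) : rnorm (Cl_deriv x) <= rnorm x.
Proof.
by rewrite [leRHS]rnorm_Cl Cl_normS lerDr (sup_norm_ge0 ab)//;
  exact: cont_diff_continuous (ClP x).
Qed.

(** Pointwise limits exist, and the convergence is uniform at a geometric rate,
    so that the limit is continuous. *)
Lemma banach_C0 : banach (Cl ab 0).
Proof.
move=> u C uC.
have uCt (t : I) n : normc (val (u n.+1) t - val (u n) t) <= C * 2^-1 ^+ n.
  by apply: le_trans (uC n); exact: (eval_le_Cl (u n.+1 - u n) t).
have [l lP] := choice (fun t => complex_fast_cauchy (uCt t)).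
have C0 : 0 <= C.
  by have := uC 0%N; rewrite mulr1; apply: le_trans; exact: rnorm_ge0.
have cl : continuous l.
  move=> t; apply/(@rnorm_cvgP R R[i] I (nbhs t) (nbhs_filter t)) => e e0.
  have [n ne] : exists n, 4 * C * 2^-1 ^+ n < e / 3.
    apply: contrapT => h.
    have : e / 3 <= 0.
      apply: (@geom_le0 _ _ (4 * C)) => n; rewrite leNgt; apply/negP => ne.
      by apply: h; exists n.
    lra.
  have /(@rnorm_cvgP R R[i] I (nbhs t) (nbhs_filter t))/(_ (e / 3)) :=
    @cont_diff_continuous _ _ _ _ _ (ClP (u n)) t.
  move=> /(_ (divr_gt0 e0 (ltr0Sn _ _))).
  apply: (@filterS _ (nbhs t) (nbhs_filter t)) => s us.
  have h1 := lP t n; have h2 := lP s n.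
  have := rnorm_distD (val (u n) t) (l t) (l s).
  have := rnorm_distD (val (u n) s) (val (u n) t) (l s).
  have := rnorm_distC (val (u n) s) (l s).
  move: us h1 h2; rewrite -!rnormc; lra.
exists (Cl_of ab (cl : cont_diff 0 l)), (4 * C) => n.
rewrite rnorm_Cl Cl_norm0E; apply: (sup_norm_le ab) => t; exact: lP.
Qed.

(** The derivatives converge in C^(l) by induction and the values at a converge;
    the limit is recovered by integration. *)
Lemma banach_Cl l : banach (Cl ab l).
Proof.
elim: l => [|l ih u C uC]; first exact: banach_C0.
have [z [D zD]] : exists z D, forall n, rnorm (z - Cl_deriv (u n)) <= D * 2^-1 ^+ n.
  apply: (ih _ C) => n; rewrite -linearB/=.
  exact: le_trans (rnorm_deriv_le _) (uC n).
have [c cP] : exists c, forall n, normc (c - val (u n) pta) <= 4 * C * 2^-1 ^+ n.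
  apply: complex_fast_cauchy => n; apply: le_trans (uC n).
  exact: (eval_le_Cl (u n.+1 - u n) pta).
exists (Cl_cst l.+1 c + Cl_prim z), (4 * C + (1 + expR (b - a)) * D) => n.
apply: le_trans (Cl_norm_deriv_bound _) _.
rewrite [leRHS]mulrDl -[(1 + _) * D * _]mulrA; apply: lerD.
  have -> : val (Cl_cst l.+1 c + Cl_prim z - u n) pta = c - val (u n) pta.
    by rewrite -[LHS]/(c + val (Cl_prim z) pta - val (u n) pta) Cl_prim_a addr0.
  exact: cP.
rewrite linearB linearD/= Cl_deriv_cst add0r Cl_deriv_prim.
by rewrite ler_wpM2l// addr_ge0 ?expR_ge0.
Qed.

End Completeness.

Section Vectors.
Variables (R : realType) (V : normedModType R[i]) (m : nat).

Lemma rnorm_cvec (y : cvec V m) : rnorm y = \sum_i rnorm (y i).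
Proof.
by rewrite /rnorm cvec_normE raddf_sum.
Qed.

Lemma rnorm_cvec_le (y : cvec V m) i : rnorm (y i) <= rnorm y.
Proof.
rewrite rnorm_cvec (bigD1 i)//= lerDl sumr_ge0// => j _; exact: rnorm_ge0.
Qed.

Lemma banach_cvec : banach V -> banach (cvec V m).
Proof.
move=> bV u C uC.
have h i : exists lD : V * R, forall n, rnorm (lD.1 - u n i) <= lD.2 * 2^-1 ^+ n.
  have [n|l [D lD]] := bV (fun n => u n i) C; last by exists (l, D).
  apply: le_trans (uC n); have := rnorm_cvec_le (u n.+1 - u n) i.
  by rewrite !ffunE.
have [f fP] := choice h.
exists [ffun i => (f i).1], (\sum_i (f i).2) => n.
rewrite rnorm_cvec mulr_suml; apply: ler_sum => i _.
by rewrite !ffunE; exact: fP.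
Qed.

End Vectors.

(** * Initial value problems for linear systems *)

Section Volterra.
Local Open Scope complex_scope.
Variables (R : realType) (a b : R) (ab : a < b).
Local Notation I := (`[a, b]%classic).
Local Notation pta := (clamp ab a).

Lemma rnorm_incl_le l (z : Cl ab l.+1) : rnorm (Cl_incl z) <= rnorm z.
Proof.
rewrite !rnorm_Cl /Cl_norm [leRHS]big_ord_recr/= lerDl (sup_norm_ge0 ab)//.
have := cont_diff_iter (leqnn _) (ClP z); exact: cont_diff_continuous.
Qed.

(** Leibniz' rule, by induction on l. *)
Lemma rnorm_mul l : exists2 D : R, 0 <= D &
  forall x y : Cl ab l, rnorm (Cl_mul x y) <= D * rnorm x * rnorm y.
Proof.
have sup_mul (x y : I -> R[i]) : continuous x -> continuous y ->
    sup_norm (fun s => x s * y s) <= sup_norm x * sup_norm y.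
  move=> cx cy; apply: (sup_norm_le ab) => t; rewrite normcM.
  by apply: ler_pM; rewrite ?normc_ge0 ?(sup_norm_ub ab).
elim: l => [|l [D D0 DP]].
  exists 1 => // x y; rewrite mul1r !rnorm_Cl !Cl_norm0E.
  by apply: sup_mul; exact: cont_diff_continuous (ClP _).
exists (1 + 2 * D); first by rewrite addr_ge0 ?mulr_ge0.
move=> x y; have cx := cont_diff_continuous (ClP x).
have cy := cont_diff_continuous (ClP y).
have dE : Cl_deriv (Cl_mul x y) =
    Cl_mul (Cl_deriv x) (Cl_incl y) + Cl_mul (Cl_incl x) (Cl_deriv y).
  apply: val_inj; have [dx _] := ClP x; have [dy _] := ClP y.
  exact: (deriv_itvM ab dx dy).
have nE (z : Cl ab l.+1) : rnorm z = sup_norm (val z) + rnorm (Cl_deriv z).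
  by rewrite rnorm_Cl Cl_normS.
rewrite [leLHS]nE dE.
have h1 := sup_mul _ _ cx cy.
have h2 := DP (Cl_deriv x) (Cl_incl y); have h3 := DP (Cl_incl x) (Cl_deriv y).
have h4 := rnormD (Cl_mul (Cl_deriv x) (Cl_incl y)) (Cl_mul (Cl_incl x) (Cl_deriv y)).
have bnd (p q : Cl ab l) : rnorm p <= rnorm x -> rnorm q <= rnorm y ->
    D * rnorm p * rnorm q <= D * (rnorm x * rnorm y).
  by move=> px qy; rewrite -mulrA ler_wpM2l// ler_pM ?rnorm_ge0.
have h5 := bnd _ _ (rnorm_deriv_le x) (rnorm_incl_le y).
have h6 := bnd _ _ (rnorm_incl_le x) (rnorm_deriv_le y).
have h7 : sup_norm (val x) * sup_norm (val y) <= rnorm x * rnorm y.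
  apply: ler_pM; [exact: (sup_norm_ge0 ab cx)|exact: (sup_norm_ge0 ab cy)| |].
    exact: sup_norm_le_Cl (ClP x).
  exact: sup_norm_le_Cl (ClP y).
rewrite -[leRHS]mulrA; move: (rnorm x * rnorm y) h5 h6 h7 => p h5 h6 h7.
have -> : (1 + 2 * D) * p = p + D * p + D * p by ring.
rewrite -addrA; apply: lerD; first exact: le_trans h1 h7.
exact: le_trans h4 (lerD (le_trans h2 h5) (le_trans h3 h6)).
Qed.

Lemma Cl_val_sum l (J : Type) (s : seq J) (P : pred J) (F : J -> Cl ab l) :
  val (\sum_(j <- s | P j) F j) = \sum_(j <- s | P j) val (F j).
Proof. by elim/big_rec2: _ => // j x y _ <-. Qed.

Lemma Cl_prim_linear l : linear (@Cl_prim R a b ab l).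
Proof.
move=> c x y; apply: val_inj.
exact: (primitive_linear ab c (cont_diff_continuous (ClP x)) (cont_diff_continuous (ClP y))).
Qed.
HB.instance Definition _ l := GRing.isLinear.Build _ _ _ _ (@Cl_prim R a b ab l)
  (@Cl_prim_linear l).

Let weight_fun (lam : R) (t : I) : R[i] := (expR (lam * (val t - a)))%:C.

Fact weight_continuous (lam : R) : cont_diff 0 (weight_fun lam).
Proof.
have cr : continuous (fun v : R => expR (lam * (v - a))).
  move=> v; have h : lam * (u - a) @[u --> v] --> lam * (v - a).
    by apply: cvgMr; apply: cvgB; [exact: cvg_id|exact: cvg_cst].
  exact: (cvg_comp _ _ h (@continuous_expR R _)).
have vc := @initial_continuous I R set_val.
move=> t; exact: (cvg_comp _ _ (cvg_comp _ _ (vc t) (cr _)) (@real_complex_continuous R _)).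
Qed.

Definition weight (lam : R) : Cl ab 0 := Cl_of ab (@weight_continuous lam).

Lemma weightK lam x : Cl_mul (weight (- lam)) (Cl_mul (weight lam) x) = x.
Proof.
apply: val_inj; apply/funext => t /=; rewrite mulrA -rmorphM/= -expRD.
by rewrite mulNr addNr expR0 mul1r.
Qed.

Lemma normc_weight lam t : normc (val (weight lam) t) = expR (lam * (val t - a)).
Proof. by rewrite [LHS]normc_real ger0_norm ?expR_ge0. Qed.

Variables (m : nat).

Section Conjugate.
Variable A : 'M[Cl ab 0]_m.

(** W^-1 J A W, where W is the multiplication by exp(lam (t - a)) and J the
    integration from a. *)
Definition volterra_conj lam (d : cvec (Cl ab 0) m) : cvec (Cl ab 0) m :=
  [ffun i => Cl_mul (weight (- lam))
    (Cl_incl (Cl_prim (\sum_j Cl_mul (A i j) (Cl_mul (weight lam) (d j)))))].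

Lemma volterra_conj_linear lam : linear (volterra_conj lam).
Proof.
move=> c x y; apply/ffunP => i; rewrite !ffunE -!linearP.
congr (Cl_mul _ (Cl_incl (Cl_prim _))).
rewrite scaler_sumr -big_split/=; apply: eq_bigr => j _.
by rewrite !ffunE !linearP.
Qed.
HB.instance Definition _ lam := GRing.isLinear.Build _ _ _ _ (volterra_conj lam)
  (volterra_conj_linear lam).

(** Since |A W d| <= |A| |d| exp(lam (t - a)), integration gains 1 / lam and
    W^-1 cancels the exponential; lam is chosen larger than twice the sum of the
    norms of the entries of A. *)
Lemma volterra_conj_contraction : exists lam,
  forall d, rnorm (volterra_conj lam d) <= 2^-1 * rnorm d.
Proof.
pose M i := \sum_j rnorm (A i j).
have M0 i : 0 <= M i by apply: sumr_ge0 => j _; exact: rnorm_ge0.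
have S0 : 0 <= \sum_i M i by apply: sumr_ge0.
pose lam := 2 * (\sum_i M i) + 1.
have lam0 : 0 < lam by rewrite ltr_wpDl// mulr_ge0.
exists lam => d.
have h i : rnorm (volterra_conj lam d i) <= M i * rnorm d / lam.
  rewrite rnorm_Cl Cl_norm0E; apply: (sup_norm_le ab) => t; rewrite ffunE.
  set x := \sum_j _.
  have xb (s : I) : normc (val x s) <= (M i * rnorm d) * expR (lam * (val s - a)).
    rewrite /x Cl_val_sum -rnormc fct_sumE; apply: le_trans (rnorm_sum _ _ _) _.
    rewrite /M !mulr_suml; apply: ler_sum => j _.
    rewrite rnormc -[val _ s]/(val (A i j) s * (val (weight lam) s * val (d j) s)).
    rewrite !normcM normc_weight [expR _ * _]mulrC mulrA ler_wpM2r ?expR_ge0//.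
    apply: ler_pM; rewrite ?normc_ge0 ?eval_le_Cl//.
    by apply: le_trans (eval_le_Cl _ _) (rnorm_cvec_le _ _).
  rewrite -[val _ t]/(val (weight (- lam)) t * primitive ab (val x) t).
  rewrite normcM normc_weight.
  have := primitive_weighted ab (cont_diff_continuous (ClP x))
    (mulr_ge0 (M0 i) (rnorm_ge0 d)) lam0 xb t.
  move=> /(ler_wpM2l (expR_ge0 (- lam * (val t - a))))/le_trans; apply.
  by rewrite mulrCA -expRD mulNr addNr expR0 mulr1.
rewrite rnorm_cvec; apply: le_trans (ler_sum _ (fun i _ => h i)) _.
rewrite -!mulr_suml mulrAC ler_wpM2r ?rnorm_ge0//.
by rewrite ler_pdivrMr// /lam; lra.
Qed.

(** Substituting y = W z turns the integral equation into a fixed point problem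
    for a contraction. *)
Lemma volterra_solvable (c : 'I_m -> R[i]) (f : cvec (Cl ab 0) m) :
  exists y : cvec (Cl ab 0) m, forall i, y i = Cl_cst ab 0 (c i) +
    Cl_incl (Cl_prim (f i - \sum_j Cl_mul (A i j) (y j))).
Proof.
have [lam lamP] := volterra_conj_contraction.
pose g : cvec (Cl ab 0) m :=
  [ffun i => Cl_mul (weight (- lam)) (Cl_cst ab 0 (c i) + Cl_incl (Cl_prim (f i)))].
have [z zE] : exists z, z = g - volterra_conj lam z.
  apply: (contraction_fixed_point (banach_cvec (banach_Cl (ab := ab) (l := 0)))) => x y.
  rewrite opprB addrC addrA subrK -linearB rnorm_distC.
  exact: lamP.
exists [ffun i => Cl_mul (weight lam) (z i)] => i.
have weightKV x : Cl_mul (weight lam) (Cl_mul (weight (- lam)) x) = x.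
  by have := weightK (- lam) x; rewrite opprK.
rewrite ffunE {1}zE !ffunE -linearB weightKV.
rewrite !linearB/= addrA; congr (_ + _ - Cl_incl (Cl_prim _)).
by apply: eq_bigr => j _; rewrite ffunE.
Qed.

(** In terms of z = W^-1 y and h = W^-1 g the equation is z = h - V z with V the
    conjugated operator, of norm at most 1/2, whence |z| <= 2 |h|. *)
Lemma volterra_estimate : exists2 C : R, 0 <= C &
  forall y g : cvec (Cl ab 0) m,
  (forall i, y i = g i - Cl_incl (Cl_prim (\sum_j Cl_mul (A i j) (y j)))) ->
  rnorm y <= C * rnorm g.
Proof.
have [lam lamP] := volterra_conj_contraction.
have [D D0 DP] := rnorm_mul 0.
pose K x : R := D * rnorm (weight x).
have K0 x : 0 <= K x by rewrite mulr_ge0 ?rnorm_ge0.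
have KP x (h : cvec (Cl ab 0) m) :
    rnorm ([ffun i => Cl_mul (weight x) (h i)] : cvec (Cl ab 0) m) <= K x * rnorm h.
  rewrite !rnorm_cvec mulr_sumr; apply: ler_sum => i _; rewrite ffunE.
  exact: DP.
exists (K lam * (2 * K (- lam))).
  exact: mulr_ge0 (K0 _) (mulr_ge0 (ler0n _ 2) (K0 _)).
move=> y g yg.
pose z : cvec (Cl ab 0) m := [ffun i => Cl_mul (weight (- lam)) (y i)].
pose h : cvec (Cl ab 0) m := [ffun i => Cl_mul (weight (- lam)) (g i)].
have yE : y = [ffun i => Cl_mul (weight lam) (z i)].
  apply/ffunP => i; rewrite !ffunE; have := weightK (- lam) (y i).
  by rewrite opprK.
have zE : z = h - volterra_conj lam z.
  apply/ffunP => i; rewrite !ffunE {1}yg linearB/=.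
  congr (_ - Cl_mul _ (Cl_incl (Cl_prim _))); apply: eq_bigr => j _.
  by rewrite {1}yE ffunE.
have zh : rnorm z <= 2 * rnorm h.
  have := lamP z; have := rnormD h (- volterra_conj lam z).
  rewrite -zE rnormN.
  by move: (rnorm z) (rnorm h) (rnorm (volterra_conj lam z)) => p q k; lra.
rewrite {1}yE; apply: le_trans (KP _ _) _; rewrite -mulrA ler_wpM2l//.
apply: le_trans zh _; rewrite -mulrA ler_wpM2l//; exact: KP.
Qed.

End Conjugate.

Section InitialValueProblem.

Lemma ode_opE l (A : 'M[Cl ab l]_m) y i :
  ode_op A y i = Cl_deriv (y i) + \sum_j Cl_mul (A i j) (Cl_incl (y j)).
Proof. by rewrite ffunE. Qed.

Lemma Cl_deriv_ode l (A : 'M[Cl ab l]_m) (y : cvec (Cl ab l.+1) m) i :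
  Cl_deriv (y i) =
  ode_op A y i - \sum_j Cl_mul (A i j) (Cl_incl (y j)).
Proof. by rewrite ode_opE addrK. Qed.

(** A solution y0 in C^(l) of the integral equation is in C^(l+1), being the
    primitive of a function in C^(l). *)
Let regularity l (A : 'M[Cl ab l]_m) (f : cvec (Cl ab l) m) (c : 'I_m -> R[i])
    (y0 : cvec (Cl ab l) m) :
  (forall i, val (y0 i) = val (Cl_cst ab l.+1 (c i) +
     Cl_prim (f i - \sum_j Cl_mul (A i j) (y0 j)))) ->
  exists y : cvec (Cl ab l.+1) m,
    ode_op A y = f /\ forall i, val (y i) pta = c i.
Proof.
move=> y0E; exists [ffun i => Cl_cst ab l.+1 (c i) +
  Cl_prim (f i - \sum_j Cl_mul (A i j) (y0 j))]; split; last first.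
  move=> i; rewrite ffunE.
  by rewrite -[LHS]/(c i + val (Cl_prim _) pta) Cl_prim_a addr0.
apply/ffunP => i; rewrite ode_opE ffunE linearD/= Cl_deriv_cst add0r Cl_deriv_prim.
rewrite -[RHS](subrK (\sum_j Cl_mul (A i j) (y0 j))); congr (_ + _).
apply: eq_bigr => j _; congr Cl_mul; apply: val_inj.
by rewrite ffunE y0E.
Qed.

(** A solution for data in C^(l+1) is first obtained with these data seen in
    C^(l); it lies in C^(l+1) and solves the integral equation there, so
    [regularity] applies again. *)
Lemma ivp_solvable l (A : 'M[Cl ab l]_m) (f : cvec (Cl ab l) m)
    (c : 'I_m -> R[i]) : exists y : cvec (Cl ab l.+1) m,
  ode_op A y = f /\ forall i, val (y i) pta = c i.
Proof.
elim: l A f => [|l ih] A f.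
  have [y0 y0E] := volterra_solvable A c f.
  by apply: (@regularity _ _ _ _ y0) => i; rewrite [in LHS]y0E.
have [y [yf yc]] := ih (map_mx (@Cl_incl _ _ _ ab l) A) [ffun i => Cl_incl (f i)].
apply: (@regularity _ _ _ _ y) => i.
have dE : val (Cl_deriv (y i)) = val (f i - \sum_j Cl_mul (A i j) (y j)).
  have /ffunP/(_ i) := yf; rewrite ode_opE ffunE => /(canRL (addrK _)) ->.
  rewrite -[LHS]/(val (Cl_incl (f i)) - val (\sum_j _)) -[RHS]/(val (f i) - val (\sum_j _)).
  by rewrite !Cl_val_sum; congr (_ - _); apply: eq_bigr => j _; rewrite mxE.
have valE k (q : Cl ab k) :
  val (Cl_cst ab k.+1 (c i) + Cl_prim q) = (fun=> c i) + primitive ab (val q) by [].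
by rewrite [in LHS](Cl_prim_deriv (y i)) yc !valE dE.
Qed.

(** The size of the data of the initial value problem that y solves. *)
Definition ivp_size l (A : 'M[Cl ab l]_m) (y : cvec (Cl ab l.+1) m) : R :=
  \sum_i normc (val (y i) pta) + rnorm (ode_op A y).

Lemma ivp_size_ge0 l (A : 'M[Cl ab l]_m) y : 0 <= ivp_size A y.
Proof.
by rewrite addr_ge0 ?rnorm_ge0// sumr_ge0// => i _; exact: normc_ge0.
Qed.

Let E : R := 1 + expR (b - a).
Let E1 : 1 <= E. Proof. by rewrite lerDl expR_ge0. Qed.
Let E0 : 0 <= E. Proof. exact: le_trans E1. Qed.

Definition cvec_incl l (y : cvec (Cl ab l.+1) m) : cvec (Cl ab l) m :=
  [ffun i => Cl_incl (y i)].

(** A bound of the lower norm of y bounds Ay, hence y' = (y' + Ay) - Ay, hence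
    the full norm of y. *)
Let bootstrap l (A : 'M[Cl ab l]_m) (C0 : R) : 0 <= C0 ->
  (forall y, rnorm (cvec_incl y) <= C0 * ivp_size A y) ->
  exists2 C : R, 0 <= C & forall y, rnorm y <= C * ivp_size A y.
Proof.
move=> C00 C0P; have [D D0 DP] := rnorm_mul l.
pose M i := \sum_j rnorm (A i j).
have M0 i : 0 <= M i by apply: sumr_ge0 => j _; exact: rnorm_ge0.
have S0 : 0 <= \sum_i M i by apply: sumr_ge0.
exists (E + E * (D * (\sum_i M i) * C0)).
  by rewrite addr_ge0// mulr_ge0// mulr_ge0// mulr_ge0.
move=> y; set N := ivp_size A y; have N0 : 0 <= N := ivp_size_ge0 A y.
have dy i : rnorm (Cl_deriv (y i)) <= rnorm (ode_op A y i) + D * M i * (C0 * N).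
  rewrite (Cl_deriv_ode A); apply: le_trans (rnormD _ _) _.
  rewrite rnormN lerD2l.
  apply: le_trans (rnorm_sum _ _ _) _.
  rewrite /M mulr_sumr mulr_suml; apply: ler_sum => j _.
  apply: le_trans (DP _ _) _; rewrite ler_wpM2l ?mulr_ge0 ?rnorm_ge0//.
  apply: le_trans (C0P y); have := rnorm_cvec_le (cvec_incl y) j.
  by rewrite ffunE.
rewrite rnorm_cvec.
apply: (@le_trans _ _ (\sum_i (normc (val (y i) pta) +
    E * (rnorm (ode_op A y i) + D * M i * (C0 * N))))).
  apply: ler_sum => i _; apply: le_trans (Cl_norm_deriv_bound _) _.
  by rewrite lerD2l ler_wpM2l.
rewrite big_split/= -mulr_sumr big_split/= -rnorm_cvec -mulr_suml -mulr_sumr.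
rewrite mulrDr addrA [leRHS]mulrDl; apply: lerD; last by rewrite -!mulrA.
rewrite /N /ivp_size mulrDr lerD2r ler_peMl// sumr_ge0// => i _.
exact: normc_ge0.
Qed.

(** For l = 0 the bound of the lower norm comes from [volterra_estimate], and
    for l > 0 from the previous level. *)
Lemma ivp_estimate l (A : 'M[Cl ab l]_m) :
  exists2 C : R, 0 <= C & forall y, rnorm y <= C * ivp_size A y.
Proof.
elim: l A => [|l ih] A.
  have [C0 C00 C0P] := volterra_estimate A.
  apply: (@bootstrap _ _ (C0 * E)); first by rewrite mulr_ge0.
  move=> y; pose g i := Cl_cst ab 1 (val (y i) pta) + Cl_prim (ode_op A y i).
  apply: le_trans (C0P (cvec_incl y) [ffun i => Cl_incl (g i)] _) _.
    move=> i; rewrite !ffunE {1}(Cl_prim_deriv (y i)) (Cl_deriv_ode A).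
    rewrite /g linearB/= addrA linearB/=; congr (_ - Cl_incl (Cl_prim _)).
    by apply: eq_bigr => j _; rewrite ffunE.
  rewrite -mulrA ler_wpM2l// rnorm_cvec.
  apply: (@le_trans _ _ (\sum_i (normc (val (y i) pta) + E * rnorm (ode_op A y i)))).
    apply: ler_sum => i _; rewrite ffunE; apply: le_trans (rnorm_incl_le _) _.
    apply: le_trans (Cl_norm_deriv_bound _) _.
    have -> : Cl_deriv (g i) = ode_op A y i.
      by rewrite [LHS]linearD/= Cl_deriv_cst add0r Cl_deriv_prim.
    have -> // : val (g i) pta = val (y i) pta.
    by rewrite -[LHS]/(val (y i) pta + val (Cl_prim _) pta) Cl_prim_a addr0.
  rewrite big_split/= -mulr_sumr -rnorm_cvec /ivp_size mulrDr lerD2r.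
  by rewrite ler_peMl// sumr_ge0// => i _; exact: normc_ge0.
have [C C0 CP] := ih (map_mx (@Cl_incl _ _ _ ab l) A).
apply: (@bootstrap _ _ C) => // y; apply: le_trans (CP _) _.
rewrite ler_wpM2l// /ivp_size lerD//.
  by under eq_bigr do rewrite ffunE.
rewrite !rnorm_cvec; apply: ler_sum => i _.
have -> : ode_op (map_mx (@Cl_incl _ _ _ ab l) A) (cvec_incl y) i =
    Cl_incl (ode_op A y i).
  rewrite !ode_opE ffunE linearD linear_sum; congr (_ + _); first exact: val_inj.
  by apply: eq_bigr => j _; rewrite mxE ffunE; exact: val_inj.
exact: rnorm_incl_le.
Qed.

End InitialValueProblem.
End Volterra.

(** * Fundamental systems and their perturbation *)

Section BoundedOperators.
Local Open Scope complex_scope.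

Lemma continuous_linear_rbounded (R : realType) (V W : normedModType R[i])
    (phi : V -> W) : linear phi -> continuous phi ->
  exists C : R, forall x, rnorm (phi x) <= C * rnorm x.
Proof.
move=> philin cphi.
have phi0 : phi 0 = 0.
  by have := philin (-1) 0 0; rewrite scaler0 addr0 scaleN1r addNr.
have phiZ c x : phi (c *: x) = c *: phi x.
  by have := philin c x 0; rewrite phi0 !addr0.
have /(@rnorm_cvgP R W V (nbhs (0 : V)) (nbhs_filter _))/(_ 1 ltr01) := cphi 0.
move=> /nbhs_ballP[e e0 eP].
have r0 : 0 < complex.Re e by move: e0; rewrite /= ltcE => /andP[].
have eE : e = (complex.Re e)%:C.
  by rewrite RRe_real// gtr0_real.
exists (2 / complex.Re e) => x; have [->|x0] := eqVneq x 0.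
  by rewrite phi0 !rnorm0 mulr0.
have x1 : 0 < rnorm x.
  rewrite lt_def rnorm_ge0 andbT; apply: contra_neq x0; exact: rnorm_eq0.
pose c : R := complex.Re e / 2 / rnorm x.
have c0 : 0 < c by rewrite !divr_gt0.
have nc : normc c%:C = c by rewrite normc_real gtr0_norm.
have bx : ball (0 : V) e (c%:C *: x).
  rewrite -ball_normE /ball_/= sub0r normrN rnormE rnormZ nc eE ltcR.
  by rewrite divfK ?gt_eqF// ltr_pdivrMr// ltr_pMr// ltr1n.
have := eP _ bx; rewrite /= phi0 sub0r rnormN phiZ rnormZ nc.
move=> /ltW; rewrite -ler_pdivlMl// mulr1.
suff -> : c^-1 = 2 / complex.Re e * rnorm x by [].
by rewrite /c; field; rewrite !gt_eqF.
Qed.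

End BoundedOperators.

Section FundamentalSystem.
Variables (R : realType) (a b : R) (ab : a < b) (m s : nat).
Local Notation pta := (clamp ab a).
Local Notation X := (cvec (Cl ab s.+1) m).

Lemma cvec_evalB (x y : X) i t : val ((x - y) i) t = val (x i) t - val (y i) t.
Proof. by rewrite !ffunE. Qed.

Lemma ivp_unique (A : 'M[Cl ab s]_m) (x y : X) : ode_op A x = ode_op A y ->
  (forall i, val (x i) pta = val (y i) pta) -> x = y.
Proof.
move=> xyL xya; have [C C0 CP] := ivp_estimate A.
apply/eqP; rewrite -subr_eq0; apply/eqP/rnorm_eq0/eqP.
rewrite eq_le rnorm_ge0 andbT; apply: le_trans (CP _) _.
rewrite /ivp_size linearB/= xyL subrr rnorm0 addr0 big1 ?mulr0// => i _.
by rewrite cvec_evalB xya subrr normc0.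
Qed.

(** The columns of the fundamental matrix normalized at a. *)
Definition fundamental (A : 'M[Cl ab s]_m) (e : 'I_m -> X) :=
  (forall j, ode_op A (e j) = 0) /\
  (forall j i, val (e j i) pta = (i == j)%:R).

Lemma fundamental_exists A : exists e, fundamental A e.
Proof.
have [e eP] := choice (fun j : 'I_m => ivp_solvable A 0 (fun i => (i == j)%:R)).
by exists e; split => [j|j i]; have [] := eP j.
Qed.

Lemma fundamental_a A e (c : 'I_m -> R[i]) i : fundamental A e ->
  val ((\sum_j c j *: e j) i) pta = c i.
Proof.
move=> [_ ea]; rewrite sum_ffunE Cl_val_sum fct_sumE (bigD1 i)//= big1 => [|j ji].
  by rewrite addr0 ffunE -[LHS]/(c i * val (e i i) pta) ea eqxx mulr1.
by rewrite ffunE -[LHS]/(c j * val (e j i) pta) ea eq_sym (negPf ji) mulr0.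
Qed.

Lemma fundamental_free A e : fundamental A e ->
  forall c : 'I_m -> R[i], \sum_j c j *: e j = 0 -> forall j, c j = 0.
Proof.
by move=> fe c c0 j; rewrite -(fundamental_a c j fe) c0 ffunE.
Qed.

Lemma fundamental_gen A e : fundamental A e ->
  forall x, ode_op A x = 0 -> exists c : 'I_m -> R[i], x = \sum_j c j *: e j.
Proof.
move=> fe x Lx; exists (fun j => val (x j) pta).
apply: (@ivp_unique A) => [|i]; last by rewrite (fundamental_a _ _ fe).
rewrite Lx linear_sum big1// => j _; rewrite linearZ/=.
by have [-> _] := fe; rewrite scaler0.
Qed.

Lemma ode_op_surj (A : 'M[Cl ab s]_m) (f : cvec (Cl ab s) m) :
  exists x, ode_op A x = f.
Proof. by have [y [yf _]] := ivp_solvable A f (fun=> 0); exists y. Qed.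

Section Dimensions.
Variables (r : nat) (A : 'M[Cl ab s]_m) (B : {linear X -> 'cV[R[i]]_r}).
Variable T : {linear X -> (cvec (Cl ab s) m * 'cV[R[i]]_r)%type}.
Hypothesis TE : forall y, T y = (ode_op A y, B y).
Variables (e : 'I_m -> X) (fe : fundamental A e).

Lemma dimension_ker_bvp :
  dimension R (ker T) = (m - \rank (char_mx B e))%:R%:E.
Proof.
apply: (dimension_ker R TE).
- by case: fe.
- exact: fundamental_free fe.
- exact: fundamental_gen fe.
Qed.

Lemma dimension_coker_bvp :
  dimension R (coker T) = (r - \rank (char_mx B e))%:R%:E.
Proof.
apply: (dimension_coker R TE).
- by case: fe.
- exact: fundamental_gen fe.
- exact: ode_op_surj.
Qed.

End Dimensions.

Variables (A : 'M[Cl ab s]_m) (A_ : nat -> 'M[Cl ab s]_m).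
Hypothesis L_cvg : forall y : X, ode_op (A_ k) y @[k --> \oo] --> ode_op A y.

(** The operator maps the constant function equal to the j-th unit vector to
    the j-th column of the coefficient matrix. *)
Lemma coef_cvg (e : R) : 0 < e ->
  \forall k \near \oo, forall i j, rnorm (A i j - A_ k i j) < e.
Proof.
move=> e0.
pose u j : X := [ffun j' => Cl_cst ab s.+1 (j' == j)%:R].
have uE (A' : 'M[Cl ab s]_m) i j : ode_op A' (u j) i = A' i j.
  rewrite ode_opE ffunE Cl_deriv_cst add0r (bigD1 j)//= big1 => [|j' jj'].
    rewrite addr0; apply: val_inj; apply/funext => t /=.
    by rewrite ffunE eqxx /= mulr1.
  apply: val_inj; apply/funext => t /=.
  by rewrite ffunE (negPf jj') /= mulr0.
have h j : \forall k \near \oo, forall i, rnorm (A i j - A_ k i j) < e.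
  have /rnorm_cvgP/(_ e e0) := @L_cvg (u j); apply: filterS => k ke i.
  apply: le_lt_trans ke; have := rnorm_cvec_le (ode_op A (u j) - ode_op (A_ k) (u j)) i.
  suff -> : (ode_op A (u j) - ode_op (A_ k) (u j)) i = A i j - A_ k i j by [].
  by rewrite -!uE !ffunE.
have : \forall k \near \oo, forall j i, rnorm (A i j - A_ k i j) < e.
  exact: filter_forall.
by apply: filterS => k h' i j.
Qed.

Lemma ode_op_dist : exists2 D : R, 0 <= D &
  forall (A1 A2 : 'M[Cl ab s]_m) (y : X),
  rnorm (ode_op A1 y - ode_op A2 y) <=
  D * (\sum_i \sum_j rnorm (A1 i j - A2 i j)) * rnorm y.
Proof.
have [D D0 DP] := @rnorm_mul _ _ _ ab s.
exists D => // A1 A2 y; rewrite rnorm_cvec mulr_sumr mulr_suml.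
apply: ler_sum => i _.
have -> : (ode_op A1 y - ode_op A2 y) i =
    \sum_j Cl_mul (A1 i j - A2 i j) (Cl_incl (y j)).
  rewrite !ffunE opprD addrACA subrr add0r -sumrB; apply: eq_bigr => j _.
  by apply: val_inj; apply/funext => t; rewrite /= -mulrBl.
apply: le_trans (rnorm_sum _ _ _) _; rewrite mulr_sumr mulr_suml.
apply: ler_sum => j _; apply: le_trans (DP _ _) _.
rewrite ler_wpM2l ?mulr_ge0 ?rnorm_ge0//.
by apply: le_trans (rnorm_incl_le _) (rnorm_cvec_le _ _).
Qed.

(** The difference d of the two solutions vanishes at a, and applying the
    operator of A to it gives (A - A_k) y_k; the estimate for A bounds d by a
    small multiple of |y_k| <= |d| + |y|. *)
Lemma solution_cvg (y : X) (y_ : nat -> X) : ode_op A y = 0 ->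
  (forall k, ode_op (A_ k) (y_ k) = 0) ->
  (forall k i, val (y_ k i) pta = val (y i) pta) ->
  forall e : R, 0 < e -> \forall k \near \oo, rnorm (y_ k - y) < e.
Proof.
move=> yL ykL yka e e0; have [C C0 CP] := ivp_estimate A.
have [D D0 DP] := ode_op_dist.
pose P := C * D * (m * m)%:R; have P0 : 0 <= P by rewrite !mulr_ge0.
have N0 := rnorm_ge0 y.
(* Small enough for P eta <= 1/4 to absorb |d|, and for P eta |y| <= e/4. *)
pose eta := Num.min 1 e / (4 * (1 + P) * (1 + rnorm y)).
have eta0 : 0 < eta.
  rewrite divr_gt0 ?lt_min ?ltr01//; apply: mulr_gt0; last by rewrite ltr_pwDl.
  by apply: mulr_gt0 => //; rewrite ltr_pwDl.
have pe : P * eta * (4 * (1 + rnorm y)) <= Num.min 1 e.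
  have -> : Num.min 1 e = (1 + P) * eta * (4 * (1 + rnorm y)).
    rewrite /eta; field; apply/andP; split; apply: lt0r_neq0; lra.
  rewrite ler_wpM2r//; last by rewrite ler_wpM2r ?(ltW eta0)// lerDr.
  by rewrite mulr_ge0// addr_ge0.
clearbody eta.
have := coef_cvg eta0; apply: filterS => k keta.
set d := y_ k - y.
have dE : rnorm d <= P * eta * rnorm (y_ k).
  apply: le_trans (CP d) _; rewrite /ivp_size big1 => [|i _]; last first.
    by rewrite cvec_evalB yka subrr normc0.
  rewrite add0r /P -!mulrA ler_wpM2l// linearB/= yL -(ykL k).
  apply: le_trans (DP _ _ _) _; rewrite -!mulrA ler_wpM2l// [leRHS]mulrA.
  rewrite ler_wpM2r ?rnorm_ge0//.
  apply: (@le_trans _ _ (\sum_(i < m) \sum_(j < m) eta)).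
    by apply: ler_sum => i _; apply: ler_sum => j _; exact/ltW/keta.
  by rewrite !sumr_const !card_ord -mulrnA mulr_natl.
have : rnorm (y_ k) <= rnorm d + rnorm y.
  by rewrite -[y_ k in leLHS](subrK y) rnormD.
have pe0 : 0 <= P * eta by rewrite mulr_ge0// ltW.
move: pe; rewrite le_min => /andP[pe1 pee] yk.
have : P * eta * rnorm (y_ k) <= P * eta * (rnorm d + rnorm y) by rewrite ler_wpM2l.
have := rnorm_ge0 d.
move: (P * eta) pe0 pe1 pee dE => q q0 q1 qe dE d0 dq.
have : q * rnorm d <= rnorm d / 4.
  have : q * 4 <= 1 by have := mulr_ge0 q0 N0; lra.
  by move=> q4; have := ler_wpM2r d0 q4; lra.
by have := mulr_ge0 q0 N0; lra.
Qed.

End FundamentalSystem.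

(* The smoothness index is [s.+1] >= 1: the spaces written C^(s) and C^(s-1) in the
   source are [Cl ab s.+1] and [Cl ab s]. *)
Theorem mainTheorem4 (R : realType) (a b : R) (ab : a < b) (m r s : nat)
    (m_ge1 : (1 <= m)%N) (r_ge1 : (1 <= r)%N)
    (A : 'M[Cl ab s]_m) (A_ : nat -> 'M[Cl ab s]_m)
    (B : {linear cvec (Cl ab s.+1) m -> 'cV[R[i]]_r})
    (B_ : nat -> {linear cvec (Cl ab s.+1) m -> 'cV[R[i]]_r})
    (B_cont : continuous B) (B__cont : forall k, continuous (B_ k))
    (LB_cvg : forall y : cvec (Cl ab s.+1) m,
      bvp_op (A_ k) (B_ k) y @[k --> \oo] --> bvp_op A B y) :
  \forall k \near \oo,
    (dimension R (ker (bvp_op (A_ k) (B_ k))) <= dimension R (ker (bvp_op A B)))%E /\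
    (dimension R (coker (bvp_op (A_ k) (B_ k))) <= dimension R (coker (bvp_op A B)))%E.
Proof.
have L_cvg y : ode_op (A_ k) y @[k --> \oo] --> ode_op A y.
  exact: (cvg_comp _ _ (LB_cvg y) cvg_fst).
have B_cvg y : B_ k y @[k --> \oo] --> B y.
  exact: (cvg_comp _ _ (LB_cvg y) cvg_snd).
have Bi_cvg y i : B_ k y i 0 @[k --> \oo] --> B y i 0.
  exact: (cvg_comp _ _ (B_cvg y) (@coord_continuous _ _ _ i 0 _)).
have [e fe] := fundamental_exists A.
have [e_ fe_] := choice (fun k => fundamental_exists (A_ k)).
have unif i : exists2 C : R, 0 <= C &
    forall k x, rnorm (B_ k x i 0) <= C * rnorm x.
  apply: (uniform_boundedness (banach_cvec (banach_Cl (ab := ab) (l := s.+1)))).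
  - by move=> k c x y; rewrite linearP !mxE.
  - move=> k; apply: continuous_linear_rbounded.
      by move=> c x y; rewrite linearP !mxE.
    move=> x; exact: (cvg_comp _ _ (B__cont k x) (@coord_continuous _ _ _ i 0 _)).
  - move=> x.
    have nc : normc (B_ k x i 0) @[k --> \oo] --> normc (B x i 0).
      exact: (cvg_comp _ _ (Bi_cvg x i) (@normc_continuous _ _)).
    have [M [_ MP]] := cvg_seq_bounded (cvgP _ nc).
    exists (M + 1) => k; have := MP (M + 1) (ltr_pwDr ltr01 (lexx M)) k Logic.I.
    by rewrite /= ger0_norm ?normc_ge0.
have entry j i (d : R) : 0 < d ->
    \forall k \near \oo, rnorm (B_ k (e_ k j) i 0 - B (e j) i 0) < d.
  move=> d0; have [C C0 CP] := unif i.
  have h0 : 0 < d / 2 / (C + 1) by rewrite !divr_gt0// ltr_wpDl.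
  have h1 : \forall k \near \oo, rnorm (e_ k j - e j) < d / 2 / (C + 1).
    apply: (solution_cvg L_cvg) h0; first by case: fe.
      by move=> k; case: (fe_ k).
    by move=> k i'; case: (fe_ k) => _ ->; case: fe => _ ->.
  have /rnorm_cvgP/(_ (d / 2) (divr_gt0 d0 (ltr0Sn _ _))) := Bi_cvg (e j) i.
  apply: filterS2 h1 => k k1 k2.
  apply: le_lt_trans (rnorm_distD (B_ k (e j) i 0) _ _) _.
  have -> : B_ k (e_ k j) i 0 - B_ k (e j) i 0 = B_ k (e_ k j - e j) i 0.
    by rewrite linearB !mxE.
  have := CP k (e_ k j - e j).
  have : C * rnorm (e_ k j - e j) <= d / 2.
    move: k1; rewrite ltr_pdivlMr ?ltr_wpDl// => k1.
    by have := rnorm_ge0 (e_ k j - e j); lra.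
  by move: k2; rewrite rnorm_distC; lra.
have [d d0 dP] := rank_near (char_mx B e).
have d0' : 0 < complex.Re d by move: d0; rewrite ltcE => /andP[].
have dE : d = ((complex.Re d)%:C)%C.
  by rewrite RRe_real// gtr0_real.
have : \forall k \near \oo, forall j i,
    rnorm (B_ k (e_ k j) i 0 - B (e j) i 0) < complex.Re d.
  by apply: filter_forall => j; apply: filter_forall => i; exact: entry.
apply: filterS => k kd.
have rk : (\rank (char_mx B e) <= \rank (char_mx (B_ k) (e_ k)))%N.
  apply: dP => j i; rewrite !mxE dE rnormE lecR; exact/ltW/kd.
have TE A' (B' : {linear cvec (Cl ab s.+1) m -> 'cV[R[i]]_r}) y :
  bvp_op A' B' y = (ode_op A' y, B' y) by [].
rewrite (dimension_ker_bvp (TE _ _) (fe_ k)) (dimension_ker_bvp (TE _ _) fe).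
rewrite (dimension_coker_bvp (TE _ _) (fe_ k)) (dimension_coker_bvp (TE _ _) fe).
by rewrite !lee_fin !ler_nat !leq_sub2l.
Qed.
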